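(* Let $L\ge 1$ and let $\gamma,\theta,\zeta,\mu_1,\dots,\mu_L$ be generic complex parameters. Let $\mathcal{Z}(\lambda_1,\dots,\lambda_L)=\langle\bar 0|\,\mathcal{B}(\lambda_1)\cdots\mathcal{B}(\lambda_L)\,|0\rangle$ be the partition function of the elliptic SOS model with domain-wall boundaries and one reflecting end (defined in the context). Then for generic $\lambda_0,\lambda_1,\dots,\lambda_L\in\mathbb{C}$, \[ \sum_{\nu=0}^{L} M_\nu(\lambda_0;\boldsymbol{\lambda})\,\mathcal{Z}(\lambda_0,\dots,\widehat{\lambda_\nu},\dots,\lambda_L)=0, \] where $\boldsymbol{\lambda}=(\lambda_1,\dots,\lambda_L)$, the caret means that $\lambda_\nu$ is omitted from the list $(\lambda_0,\lambda_1,\dots,\lambda_L)$, and \[ M_0(\lambda_0;\boldsymbol{\lambda})=\bar\Lambda_{\mathcal A}(\lambda_0)-\Lambda_{\mathcal A}(\lambda_0)\prod_{j=1}^{L}\frac{[\lambda_j-\lambda_0+\gamma,\,\lambda_j+\lambda_0]}{[\lambda_j-\lambda_0,\,\lambda_j+\lambda_0+\gamma]}, \] and for $1\le i\le L$ \[ \begin{aligned} M_i(\lambda_0;\boldsymbol{\lambda})={}&\frac{[2\lambda_i,\,\gamma,\,\theta+(L-1)\gamma+\lambda_i-\lambda_0]}{[2\lambda_i+\gamma,\,\lambda_i-\lambda_0,\,\theta+(L-1)\gamma]}\,\Lambda_{\mathcal A}(\lambda_i)\prod_{j\ne i}\frac{[\lambda_j-\lambda_i+\gamma,\,\lambda_j+\lambda_i]}{[\lambda_j-\lambda_i,\,\lambda_j+\lambda_i+\gamma]}\\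 &+\frac{[\gamma,\,\theta+(L-2)\gamma-\lambda_i-\lambda_0,\,\theta-(L-1)\gamma]}{[\lambda_i+\lambda_0+\gamma,\,\theta+(L-1)\gamma,\,\theta-L\gamma]}\,\Lambda_{\tilde{\mathcal D}}(\lambda_i)\prod_{j\ne i}\frac{[\lambda_i-\lambda_j+\gamma,\,\lambda_i+\lambda_j+2\gamma]}{[\lambda_i-\lambda_j,\,\lambda_i+\lambda_j+\gamma]}, \end{aligned} \] with products over $j\in\{1,\dots,L\}$, and \[ \begin{aligned} \Lambda_{\mathcal A}(\lambda)&=[\zeta+\lambda]\frac{[\theta+\zeta-\lambda]}{[\theta+\zeta+\lambda]}\prod_{j=1}^L[\lambda-\mu_j+\gamma,\,\lambda+\mu_j+\gamma],\\ \Lambda_{\tilde{\mathcal D}}(\lambda)&=[\zeta-\lambda-\gamma]\frac{[2\lambda,\,\theta+\zeta+\lambda+\gamma,\,\theta-L\gamma]}{[2\lambda+\gamma,\,\theta+\zeta+\lambda,\,\theta-(L-1)\gamma]}\prod_{j=1}^L[\lambda-\mu_j,\,\lambda+\mu_j],\\ \bar\Lambda_{\mathcal A}(\lambda)&=[\zeta-\lambda]\frac{[\gamma,\,\theta+(L-1)\gamma-2\lambda]}{[2\lambda+\gamma,\,\theta+(L-1)\gamma]}\prod_{j=1}^L[\lambda-\mu_j+\gamma,\,\lambda+\mu_j+\gamma]\\ &\quad+[\zeta+\lambda+\gamma]\frac{[2\lambda,\,\theta+\zeta-\lambda-\gamma,\,\theta+L\gamma]}{[2\lambda+\gamma,\,\theta+\zeta+\lambda,\,\theta+(L-1)\gamma]}\prod_{j=1}^L[\lambda-\mu_j,\,\lambda+\mu_j].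 \end{aligned} \]
   Context: Fix $\tau\in\mathbb{C}$ with $\operatorname{Im}\tau>0$ and let $f(\lambda)=\sum_{n\ge0}(-1)^n e^{\mathrm{i}n(n+1)\pi\tau}\sinh((2n+1)\lambda)$ (equivalently $f(\lambda)=-\tfrac{\mathrm{i}}{2}e^{-\mathrm{i}\pi\tau/4}\vartheta_1(\mathrm{i}\lambda|\tau)$). Write $[x]:=f(x)$ and $[x_1,x_2,\dots,x_k]:=f(x_1)f(x_2)\cdots f(x_k)$. Let $V=\mathbb{C}^2$ with basis $e_+,e_-$ and $h\in\mathrm{End}(V)$, $he_\pm=\pm e_\pm$. Define $R(\lambda,\theta)\in\mathrm{End}(V\otimes V)$ by its matrix in the ordered basis $(e_+\otimes e_+,e_+\otimes e_-,e_-\otimes e_+,e_-\otimes e_-)$: $R=\begin{pmatrix}a_+&0&0&0\\0&b_+&c_+&0\\0&c_-&b_-&0\\0&0&0&a_-\end{pmatrix}$, with $a_\pm(\lambda,\theta)=[\lambda+\gamma]$, $b_\pm(\lambda,\theta)=[\lambda][\theta\mp\gamma]/[\theta]$, $c_\pm(\lambda,\theta)=[\theta\mp\lambda][\gamma]/[\theta]$. Let $V_0\cong V$ (auxiliary space) and $W=V_1\otimes\cdots\otimes V_L$ with $V_j\cong V$; subscripts denote the tensor factors on which an operator acts, $h_i$ is $h$ acting on $V_i$, and a dynamical argument of the form $\theta-\gamma\sum_{i\in S}h_i$ means that $\theta$ is replaced by this operator (diagonal in the standard basis of the factors $V_i$, $i\in S$, which commute with the rest). $R_{0j}(\lambda,\cdot)$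 is $R$ acting on $V_0\otimes V_j$ and $R_{j0}$ is $R$ acting on $V_j\otimes V_0$ with $V_j$ as first leg. Define $T_0(\lambda,\theta)=R_{01}(\lambda-\mu_1,\theta-\gamma\sum_{i=2}^Lh_i)\,R_{02}(\lambda-\mu_2,\theta-\gamma\sum_{i=3}^Lh_i)\cdots R_{0L}(\lambda-\mu_L,\theta)$, $\bar T_0(\lambda,\theta)=R_{L0}(\lambda+\mu_L,\theta)\,R_{L-1,0}(\lambda+\mu_{L-1},\theta-\gamma h_L)\cdots R_{10}(\lambda+\mu_1,\theta-\gamma\sum_{i=2}^Lh_i)$. Let $K_0(\lambda,\theta)=\mathrm{diag}(k_+(\lambda,\theta),k_-(\lambda,\theta))$ on $V_0$ with $k_+=[\zeta+\lambda][\theta+\zeta-\lambda]/[\theta+\zeta+\lambda]$, $k_-=[\zeta-\lambda]$. Let $\mathcal{T}_0(\lambda)=T_0(\lambda,\theta)K_0(\lambda,\theta)\bar T_0(\lambda,\theta)\in\mathrm{End}(V_0\otimes W)$ and define $\mathcal{A}(\lambda),\mathcal{B}(\lambda),\mathcal{C}(\lambda),\mathcal{D}(\lambda)\in\mathrm{End}(W)$ by $\mathcal{T}_0(\lambda)(e_+\otimes w)=e_+\otimes\mathcal{A}(\lambda)w+e_-\otimes\mathcal{C}(\lambda)w$ and $\mathcal{T}_0(\lambda)(e_-\otimes w)=e_+\otimes\mathcal{B}(\lambda)w+e_-\otimes\mathcal{D}(\lambda)w$. Let $|0\rangle=e_+^{\otimes L}\in W$ and, for $v\in W$, let $\langle\bar0|v$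 denote the coefficient of $e_-^{\otimes L}$ in $v$. The partition function is $\mathcal{Z}(\lambda_1,\dots,\lambda_L)=\langle\bar0|\mathcal{B}(\lambda_1)\cdots\mathcal{B}(\lambda_L)|0\rangle$. *)

(* Defs.v *)
From HB Require Import structures.
From mathcomp Require Import all_boot all_order all_algebra.
From mathcomp Require Import all_classical all_reals.
From mathcomp Require Import topology normedtype sequences exp trigo.
From mathcomp Require Import complex.

Set Implicit Arguments.
Unset Strict Implicit.
Unset Printing Implicit Defensive.

Import Order.TTheory GRing.Theory Num.Theory numFieldNormedType.Exports.
Local Open Scope ring_scope.
Local Open Scope complex_scope.

Section Model.
Variable R : realType.
Local Notation C := (R[i]).

Definition cexp (z : C) : C :=
  (expR (complex.Re z))%:C * ((cos (complex.Im z)) +i* (sin (complex.Im z))).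

Definition csinh (z : C) : C := (cexp z - cexp (- z)) / 2.

Definition fterm (tau lam : C) (n : nat) : C :=
  (-1) ^+ n * cexp ('i * (n * n.+1)%:R * (pi%:C) * tau)
    * csinh ((n.*2.+1)%:R * lam).

(* f(lambda), the sum of the (absolutely convergent for Im tau > 0) complex
   series, computed as (sum of real parts) + i (sum of imaginary parts). *)
Definition ef (tau lam : C) : C :=
  (limn (series (fun n => complex.Re (fterm tau lam n))))
  +i* (limn (series (fun n => complex.Im (fterm tau lam n)))).

(* sign of a basis vector: e_+ <-> true, e_- <-> false ; h e_s = sgn s e_s *)
Definition sgn (b : bool) : C := if b then 1 else -1.

(* Generic operators on a finite basis T: A x y = coefficient of x in A(e_y) *)
Definition opmul (T : finType) (A B : T -> T -> C) : T -> T -> C :=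
  fun x y => \sum_(z : T) A x z * B z y.
Definition opid (T : finType) : T -> T -> C := fun x y => (x == y)%:R.
Definition opprod (T : finType) (s : seq (T -> T -> C)) : T -> T -> C :=
  foldr (@opmul T) (@opid T) s.

Variables (tau gamma : C).
Local Notation "[ x ]" := (ef tau x).

(* The R-matrix: entry (o1 o2 | i1 i2) = coefficient of e_o1 (x) e_o2 in
   R(lambda,theta)(e_i1 (x) e_i2). *)
Definition Rmat (lam th : C) (o1 o2 i1 i2 : bool) : C :=
  if (i1 == i2) then
    (if (o1 == i1) && (o2 == i2) then [lam + gamma] else 0)
  else if i1 then
    (if o1 && ~~ o2 then [lam] * [th - gamma] / [th]
     else if ~~ o1 && o2 then [th + lam] * [gamma] / [th]
     else 0)
  else
    (if o1 && ~~ o2 then [th - lam] * [gamma] / [th]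
     else if ~~ o1 && o2 then [lam] * [th + gamma] / [th]
     else 0).

Variable L : nat.
(* basis of W = V_1 (x) ... (x) V_L; site k : 'I_L is V_{k+1} *)
Definition Wst := {ffun 'I_L -> bool}.
(* basis of V_0 (x) W *)
Definition St := (bool * Wst)%type.

Definition dynth (th : C) (j : 'I_L) (s : Wst) : C :=
  th - gamma * \sum_(i < L | (j < i)%N) sgn (s i).

Definition R0j (lam th : C) (j : 'I_L) : St -> St -> C :=
  fun x y => if [forall k, (k != j) ==> (x.2 k == y.2 k)]
             then Rmat lam (dynth th j y.2) x.1 (x.2 j) y.1 (y.2 j) else 0.

Definition Rj0 (lam th : C) (j : 'I_L) : St -> St -> C :=
  fun x y => if [forall k, (k != j) ==> (x.2 k == y.2 k)]
             then Rmat lam (dynth th j y.2) (x.2 j) x.1 (y.2 j) y.1 else 0.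

Variables (theta zeta : C) (mu : 'I_L -> C).

Definition Tmon (lam : C) : St -> St -> C :=
  opprod [seq R0j (lam - mu j) theta j | j <- enum 'I_L].
Definition Tbar (lam : C) : St -> St -> C :=
  opprod (rev [seq Rj0 (lam + mu j) theta j | j <- enum 'I_L]).

Definition kplus (lam : C) : C :=
  [zeta + lam] * [theta + zeta - lam] / [theta + zeta + lam].
Definition kminus (lam : C) : C := [zeta - lam].

Definition Kmat (lam : C) : St -> St -> C :=
  fun x y => if x == y then (if x.1 then kplus lam else kminus lam) else 0.

Definition Tdouble (lam : C) : St -> St -> C :=
  opprod [:: Tmon lam; Kmat lam; Tbar lam].

Definition Bop (lam : C) : Wst -> Wst -> C :=
  fun w' w => Tdouble lam (true, w') (false, w).

Definition Zpf (l : 'I_L -> C) : C :=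
  opprod [seq Bop (l k) | k <- enum 'I_L] [ffun=> false] [ffun=> true].

Definition Lam_A (lam : C) : C :=
  [zeta + lam] * [theta + zeta - lam] / [theta + zeta + lam]
  * \prod_(j < L) ([lam - mu j + gamma] * [lam + mu j + gamma]).

Definition Lam_Dt (lam : C) : C :=
  [zeta - lam - gamma]
  * ([2 * lam] * [theta + zeta + lam + gamma] * [theta - L%:R * gamma])
  / ([2 * lam + gamma] * [theta + zeta + lam] * [theta - (L%:R - 1) * gamma])
  * \prod_(j < L) ([lam - mu j] * [lam + mu j]).

Definition Lam_Abar (lam : C) : C :=
  [zeta - lam]
  * ([gamma] * [theta + (L%:R - 1) * gamma - 2 * lam])
  / ([2 * lam + gamma] * [theta + (L%:R - 1) * gamma])
  * \prod_(j < L) ([lam - mu j + gamma] * [lam + mu j + gamma])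
  + [zeta + lam + gamma]
  * ([2 * lam] * [theta + zeta - lam - gamma] * [theta + L%:R * gamma])
  / ([2 * lam + gamma] * [theta + zeta + lam] * [theta + (L%:R - 1) * gamma])
  * \prod_(j < L) ([lam - mu j] * [lam + mu j]).

(* lams k = lambda_{k+1}, k : 'I_L ; l0 = lambda_0 *)
Definition M0 (l0 : C) (lams : 'I_L -> C) : C :=
  Lam_Abar l0
  - Lam_A l0 * \prod_(j < L)
      (([lams j - l0 + gamma] * [lams j + l0])
       / ([lams j - l0] * [lams j + l0 + gamma])).

Definition Mi (l0 : C) (lams : 'I_L -> C) (i : 'I_L) : C :=
  let li := lams i in
  ([2 * li] * [gamma] * [theta + (L%:R - 1) * gamma + li - l0])
  / ([2 * li + gamma] * [li - l0] * [theta + (L%:R - 1) * gamma])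
  * Lam_A li
  * \prod_(j < L | j != i)
      (([lams j - li + gamma] * [lams j + li])
       / ([lams j - li] * [lams j + li + gamma]))
  + ([gamma] * [theta + (L%:R - 2) * gamma - li - l0]
       * [theta - (L%:R - 1) * gamma])
  / ([li + l0 + gamma] * [theta + (L%:R - 1) * gamma]
       * [theta - L%:R * gamma])
  * Lam_Dt li
  * \prod_(j < L | j != i)
      (([li - lams j + gamma] * [li + lams j + 2 * gamma])
       / ([li - lams j] * [li + lams j + gamma])).

Definition Mcoef (lam : 'I_L.+1 -> C) (nu : 'I_L.+1) : C :=
  let lams := fun k : 'I_L => lam (lift ord0 k) in
  match unlift ord0 nu with
  | None => M0 (lam ord0) lams
  | Some i => Mi (lam ord0) lams i
  end.

End Model.

(* Main.v *)
Require Import Defs.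
From HB Require Import structures.
From mathcomp Require Import all_boot all_order all_algebra.
From mathcomp Require Import all_classical all_reals.
From mathcomp Require Import topology normedtype sequences exp trigo.
From mathcomp Require Import complex.
From mathcomp Require Import ring lra zify.
Import Order.TTheory GRing.Theory Num.Theory.
Import numFieldNormedType.Exports.
Local Open Scope ring_scope.
Local Open Scope complex_scope.
Set Implicit Arguments.
Unset Strict Implicit.
Unset Printing Implicit Defensive.

(** The theta function [f] enters only through its oddness and Fay's three-term
    identity.  The latter is the Pluecker relation for the vectors
    [(theta_odd, theta_even)], because [4 f(x+y) f(x-y)] equals
    [theta_odd x * theta_even y - theta_odd y * theta_even x]: split the double
    series over [(m, n)] according to the parity of [m - n].

    The dynamical Yang-Baxter equation gives, by induction on the number of
    sites, a reflection equation for the double row operator.  Crossing symmetry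
    expresses [D(l)] through [A(l)] and [A(-l-gamma)], and [B(-l-gamma)] through
    [B(l)], so the reflection equation yields an exchange relation between [A]
    and [B] alone.  Moving [A(l0)] to the right through [B(l1)...B(lL)|0>]
    produces, by induction on the number of [B]'s, a multiple of this vector
    plus one term for each [li] replaced by [l0].  On the other hand [<0bar|] is
    a left eigenvector of [A(l0)].  Comparing the two gives the claim.

    Two points avoid genericity assumptions beyond the stated ones.  The [B]'s
    are commuted only under the factor [f(l1-l0+gamma) f(l1+l0)] of the exchange
    coefficient, which is also the factor under which the reflection equation
    says that they commute.  And the exchange relation is derived in a gauge
    where [b_+] and [b_-] have swapped their factors [f(theta -+ gamma)]: in
    the gauge of the model it would require
    [f(theta - (L+1) gamma)] to be nonzero. *)

(** * Fay's identity for the theta series *)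

Section Windows.
Local Open Scope classical_set_scope.
Variable R : realType.

(** The range -N <= n < N, stable under n -> -1 - n. This reflection exchanges [Posz i] and
    [Negz i], which folds a series over all integers into one over n >= 0. *)
Definition window (N : nat) : seq int :=
  [seq Posz i | i <- iota 0 N] ++ [seq Negz i | i <- iota 0 N].

Lemma mem_window N (n : int) : (n \in window N) = (- N%:Z <= n < N%:Z).
Proof.
rewrite mem_cat; case: n => n.
- rewrite mem_map ?mem_iota; last by move=> ? ? [].
  rewrite [X in _ || X](_ : _ = false); first by lia.
  by apply/mapP => -[].
- rewrite [X in _ || X]mem_map ?mem_iota; last by move=> ? ? [].
  rewrite [X in X || _](_ : _ = false); first by lia.
  by apply/mapP => -[].
Qed.

Lemma window_uniq N : uniq (window N).
Proof.
rewrite cat_uniq !map_inj_uniq ?iota_uniq //=; try by move=> ? ? [].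
by rewrite andbT; apply/hasPn => _ /mapP[i _ ->]; apply/mapP => -[].
Qed.

Lemma big_window (V : zmodType) N (F : int -> V) :
  \sum_(n <- window N) F n = \sum_(0 <= i < N) (F (Posz i) + F (Negz i)).
Proof. by rewrite /index_iota subn0 big_split big_cat !big_map. Qed.

Definition wsum (F : int -> R) : R^nat := fun N => \sum_(n <- window N) F n.

Lemma wsum_geometric_cvg (F : int -> R) (K : R) :
  (forall n, `|F n| <= K * expR (- 1) ^+ `|n|%N) -> cvgn (wsum F).
Proof.
move=> hF; rewrite /wsum; under eq_fun => N do rewrite big_window.
apply: (@normed_cvg _ R^o).
apply: (@series_le_cvg _ _ (fun i => (K + K) * expR (- 1) ^+ i)).
- by move=> i /=.
- move=> i; rewrite mulr_ge0 ?exprn_ge0 ?expR_ge0 //.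
  by have := le_trans (normr_ge0 _) (hF 0); rewrite mulr1 => K0; rewrite
    addr_ge0.
- move=> i /=; apply: le_trans (ler_normD _ _) _; rewrite mulrDl.
  apply: lerD; first exact: hF.
  apply: le_trans (hF _) _; apply: ler_wpM2l.
    by have := le_trans (normr_ge0 _) (hF 0); rewrite mulr1.
  rewrite /= exprS ler_piMl ?exprn_ge0 ?expR_ge0 //.
  by rewrite -[leRHS]expR0 ler_expR lerN10.
- apply: is_cvg_geometric_series; rewrite ger0_norm ?expR_ge0 //.
  by rewrite -[ltRHS]expR0 ltr_expR ltrN10.
Qed.

End Windows.

(** * Rearranging absolutely convergent double series *)

Section Rearrangement.
Local Open Scope classical_set_scope.
Variable R : realType.
Implicit Types (w : int -> int -> R) (u v : int -> R).

Definition box_sum (V : zmodType) N (P : int -> int -> bool) (w : int -> int ->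
  V) :=
  \sum_(a <- window N) \sum_(b <- window N | P a b) w a b.

Definition square M (a b : int) := (a \in window M) && (b \in window M).

Lemma window_sub (V : zmodType) M N (P : pred int) (F : int -> V) : (M <= N)%N
  ->
  \sum_(n <- window N | (n \in window M) && P n) F n = \sum_(n <- window M | P
    n) F n.
Proof.
move=> MN; rewrite -big_filter_cond; apply: perm_big; apply: uniq_perm; rewrite
  ?filter_uniq ?window_uniq // => n.
rewrite mem_filter !mem_window; lia.
Qed.

Lemma box_sum_square M N w : (M <= N)%N ->
  box_sum N (square M) w = \sum_(a <- window M) \sum_(b <- window M) w a b.
Proof.
move=> MN; rewrite /box_sum /square -(window_sub xpredT _ MN) [RHS]big_mkcond
  /=.
apply: eq_bigr => a _; rewrite andbT; case: ifP => aM /=.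
  by rewrite -(window_sub xpredT _ MN); apply: eq_bigl => b; rewrite andbT.
by rewrite big_pred0.
Qed.

(** The terms of the difference lie in the box N and outside the square M, where the dominating
    double series contributes its increment from M to N. *)
Lemma box_sum_dominated w u v M N (P : int -> int -> bool) : (M <= N)%N ->
  (forall a b, `|w a b| <= u a * v b) ->
  (forall a b, square M a b -> P a b) ->
  `|box_sum N P w - box_sum N (square M) w| <=
  wsum u N * wsum v N - wsum u M * wsum v M.
Proof.
move=> MN hw hP.
have prodE K : wsum u K * wsum v K
    = \sum_(a <- window K) \sum_(b <- window K) u a * v b.
  by rewrite /wsum mulr_suml; apply: eq_bigr => a _; rewrite mulr_sumr.
rewrite !prodE -(box_sum_square (fun a b => u a * v b) MN) /box_sum -!sumrB.
apply: le_trans (ler_norm_sum _ _ _) _; apply: ler_sum => a _.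
rewrite ![\sum_(b <- _ | P a b) _]big_mkcond ![\sum_(b <- _ | square M a b)
  _]big_mkcond.
rewrite -!sumrB; apply: le_trans (ler_norm_sum _ _ _) _; apply: ler_sum => b _.
have := hP a b; have u0 := le_trans (normr_ge0 _) (hw a b).
case: (square M a b) => [->//|_]; first by rewrite !subrr normr0.
by case: (P a b); rewrite !subr0 ?normr0.
Qed.

(** Absolute convergence makes the shape of the region immaterial: a region lying between the square
    of size M and the box of size 2M changes the sum by at most the increment of a convergent
    sequence. *)
Lemma box_sum_cvg w u v (P : nat -> int -> int -> bool) (l : R) :
  cvgn (wsum u) -> cvgn (wsum v) -> (forall a b, `|w a b| <= u a * v b) ->
  (forall M a b, square M a b -> P M a b) ->
  (fun M => \sum_(a <- window M) \sum_(b <- window M) w a b) @ \oo --> l ->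
  (fun M => box_sum M.*2 (P M) w) @ \oo --> l.
Proof.
move=> cu cv hw hP hl.
pose z M := wsum u M * wsum v M.
have cz : z @ \oo --> limn z by apply: (@is_cvgM R^o).
have z2 : (fun M => z M.*2) @ \oo --> limn z.
  apply: (cvg_comp _ _ _ cz); apply/cvgnyPge => k; near=> n.
  apply: (@leq_trans n); last by rewrite -addnn leq_addr.
  by near: n; exact: nbhs_infty_ge.
have z0 : (fun M => z M.*2 - z M) @ \oo --> (0 : R).
  by rewrite -(subrr (limn z)); apply: (@cvgB _ R^o).
have d0 : (fun M => box_sum M.*2 (P M) w - box_sum M.*2 (square M) w) @ \oo -->
  (0 : R).
  apply: (@squeeze_cvgr _ _ _ _ (fun M => - (z M.*2 - z M)) (fun M => z M.*2 -
    z M)).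
  - apply: nearW => M; rewrite -ler_norml.
    by apply: box_sum_dominated => //; [rewrite -addnn leq_addr | exact: hP].
  - by rewrite -oppr0; apply: (@cvgN _ R^o).
  - exact: z0.
rewrite (_ : (fun M => _) = (fun M => box_sum M.*2 (P M) w - box_sum M.*2
  (square M) w
    + \sum_(a <- window M) \sum_(b <- window M) w a b)); last first.
  apply/funext => M; rewrite box_sum_square ?subrK //.
  by rewrite -addnn leq_addr.
by rewrite -[l]add0r; apply: (@cvgD _ R^o).
Unshelve. all: end_near.
Qed.
End Rearrangement.

Section BoxRearrangement.
Variable V : zmodType.
Implicit Types F : int -> int -> V.

Let pairs N := [seq (a, b) | a <- window N, b <- window N].

Let mem_pairs N p : (p \in pairs N) = (p.1 \in window N) && (p.2 \in window N).
Proof.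
case: p => a b; apply/allpairsP/andP => [[[c d] /= [hc hd [-> ->]]]|[/= ha hb]].
  by [].
by exists (a, b).
Qed.

Let pairs_uniq N : uniq (pairs N).
Proof. by apply: allpairs_uniq; rewrite ?window_uniq // => -[? ?] [? ?]. Qed.

Let box_sumE N P F : box_sum N P F = \sum_(p <- pairs N | P p.1 p.2) F p.1 p.2.
Proof.
rewrite big_mkcond big_allpairs /=; apply: eq_bigr => a _.
by rewrite big_mkcond.
Qed.

(** The pairs (a + b, a - b) are those with even difference, the pairs (a + b, b - a - 1) those with
    odd difference. Solving for a and b stays inside the same window, so no term is lost. *)
Lemma box_sum_parity N F :
  \sum_(m <- window N) \sum_(n <- window N) F m n =
  box_sum N (fun a b => (a + b \in window N) && (a - b \in window N))
    (fun a b => F (a + b) (a - b)) +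
  box_sum N (fun a b => (a + b \in window N) && (b - a - 1 \in window N))
    (fun a b => F (a + b) (b - a - 1)).
Proof.
have -> : \sum_(m <- window N) \sum_(n <- window N) F m n =
    \sum_(p <- pairs N) F p.1 p.2 by rewrite big_allpairs.
rewrite (bigID (fun p : int * int => ((p.1 - p.2) %% 2)%Z == 0)) /= !box_sumE.
congr (_ + _).
- rewrite -big_filter -[RHS]big_filter.
  rewrite -[RHS](big_map (fun q : int * int => (q.1 + q.2, q.1 - q.2)) xpredT
    (fun p => F p.1 p.2)); apply: perm_big; apply: uniq_perm.
  + by rewrite filter_uniq.
  + rewrite map_inj_uniq ?filter_uniq // => -[a b] [c d] /= [h1 h2].
    by congr (_, _); lia.
  move=> [m n]; rewrite mem_filter mem_pairs /=; apply/idP/mapP.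
    move=> /and3P[mn mN nN]; exists (((m + n) %/ 2)%Z, ((m - n) %/ 2)%Z).
      rewrite mem_filter mem_pairs /=; move: mN nN mn; rewrite !mem_window; lia.
    by rewrite /=; congr (_, _); lia.
  move=> [[a b]]; rewrite mem_filter mem_pairs /= !mem_window => h [-> ->].
  by move: h; lia.
- rewrite -big_filter -[RHS]big_filter.
  rewrite -[RHS](big_map (fun q : int * int => (q.1 + q.2, q.2 - q.1 - 1))
    xpredT
    (fun p => F p.1 p.2)); apply: perm_big; apply: uniq_perm.
  + by rewrite filter_uniq.
  + rewrite map_inj_uniq ?filter_uniq // => -[a b] [c d] /= [h1 h2].
    by congr (_, _); lia.
  move=> [m n]; rewrite mem_filter mem_pairs /=; apply/idP/mapP.
    move=> /and3P[mn mN nN]; exists (((m - n - 1) %/ 2)%Z, ((m + n + 1) %/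
      2)%Z).
      rewrite mem_filter mem_pairs /=; move: mN nN mn; rewrite !mem_window; lia.
    by rewrite /=; congr (_, _); lia.
  move=> [[a b]]; rewrite mem_filter mem_pairs /= !mem_window => h [-> ->].
  by move: h; lia.
Qed.

End BoxRearrangement.

(** * Gaussian series over the integers with complex exponents *)

Section ThetaSeries.
Local Open Scope classical_set_scope.
Local Open Scope complex_scope.
Variable R : realType.
Local Notation C := (R[i]).
Local Notation Re := complex.Re.
Local Notation Im := complex.Im.

Lemma ReM (x y : C) : Re (x * y) = Re x * Re y - Im x * Im y.
Proof. by case: x; case: y. Qed.
Lemma ImM (x y : C) : Im (x * y) = Re x * Im y + Im x * Re y.
Proof. by case: x; case: y. Qed.
Lemma ReD (x y : C) : Re (x + y) = Re x + Re y. Proof. by case: x; case: y. Qed.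
Lemma ImD (x y : C) : Im (x + y) = Im x + Im y. Proof. by case: x; case: y. Qed.
Lemma ReN (x : C) : Re (- x) = - Re x. Proof. by case: x. Qed.
Lemma ImN (x : C) : Im (- x) = - Im x. Proof. by case: x. Qed.
Lemma Re_sum I (r : seq I) (P : pred I) (F : I -> C) :
  Re (\sum_(i <- r | P i) F i) = \sum_(i <- r | P i) Re (F i).
Proof. by apply: (big_morph _ ReD). Qed.
Lemma Im_sum I (r : seq I) (P : pred I) (F : I -> C) :
  Im (\sum_(i <- r | P i) F i) = \sum_(i <- r | P i) Im (F i).
Proof. by apply: (big_morph _ ImD). Qed.

Lemma cexpD (z w : C) : cexp (z + w) = cexp z * cexp w.
Proof.
case: z => a b; case: w => c d; rewrite /cexp /= expRD cosD sinD.
apply/eqP; rewrite eq_complex /=; apply/andP; split; apply/eqP; ring.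
Qed.

Lemma Re_cexp_le (z : C) : `|Re (cexp z)| <= expR (Re z).
Proof.
rewrite /cexp /= mul0r subr0 normrM ger0_norm ?expR_ge0 //.
by rewrite ler_piMr ?expR_ge0 // ler_norml cos_geN1 cos_le1.
Qed.
Lemma Im_cexp_le (z : C) : `|Im (cexp z)| <= expR (Re z).
Proof.
rewrite /cexp /= mul0r addr0 normrM ger0_norm ?expR_ge0 //.
by rewrite ler_piMr ?expR_ge0 // ler_norml sin_geN1 sin_le1.
Qed.

Definition ccvg (u : nat -> C) (l : C) :=
  (fun n => Re (u n)) @ \oo --> Re l /\ (fun n => Im (u n)) @ \oo --> Im l.

Lemma ccvgM u v l m : ccvg u l -> ccvg v m -> ccvg (fun n => u n * v n) (l * m).
Proof.
move=> [u1 u2] [v1 v2]; split.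
  under eq_fun => n do rewrite ReM.
  by rewrite ReM; apply: (@cvgB _ R^o); apply: (@cvgM R^o).
under eq_fun => n do rewrite ImM.
by rewrite ImM; apply: (@cvgD _ R^o); apply: (@cvgM R^o).
Qed.

Lemma ccvgD u v l m : ccvg u l -> ccvg v m -> ccvg (fun n => u n + v n) (l + m).
Proof.
move=> [u1 u2] [v1 v2]; split.
  under eq_fun => n do rewrite ReD.
  by rewrite ReD; apply: (@cvgD _ R^o).
under eq_fun => n do rewrite ImD.
by rewrite ImD; apply: (@cvgD _ R^o).
Qed.

Lemma ccvgN u l : ccvg u l -> ccvg (fun n => - u n) (- l).
Proof.
move=> [u1 u2]; split.
  by under eq_fun => n do rewrite ReN; rewrite ReN; apply: (@cvgN _ R^o).
by under eq_fun => n do rewrite ImN; rewrite ImN; apply: (@cvgN _ R^o).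
Qed.

Lemma ccvg_unique u l m : ccvg u l -> ccvg u m -> l = m.
Proof.
move=> [u1 u2] [v1 v2]; apply/eqP; rewrite eq_complex; apply/andP; split;
  apply/eqP.
  exact: (cvg_unique _ u1 v1).
exact: (cvg_unique _ u2 v2).
Qed.

Definition gauss (p q s : C) (n : int) : C :=
  cexp (p * n%:~R ^+ 2 + q * n%:~R + s).

Lemma intr_complex (n : int) : (n%:~R : C) = (n%:~R)%:C.
Proof. by rewrite rmorph_int. Qed.

(** Completion of the square after setting aside one copy of [|x|], which then supplies the
    geometric decay in [gauss_bound]. *)
Lemma quadratic_bound (A B D x : R) : 0 < A ->
  - A * x ^+ 2 + B * x + D <= (`|B| + 1) ^+ 2 / (4 * A) + D - `|x|.
Proof.
move=> A0; set b := `|B| + 1; rewrite -(real_normK (num_real x)).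
have Bx : B * x <= `|B| * `|x| by rewrite -normrM ler_norm.
have := mulr_ge0 (ltW A0) (sqr_ge0 (`|x| - b / (2 * A))).
rewrite (_ : A * _ = A * `|x| ^+ 2 - b * `|x| + b ^+ 2 / (4 * A)); last first.
  by field; rewrite gt_eqF.
rewrite /b in Bx *; move: (_ / (4 * A)) => c; nra.
Qed.

Lemma gauss_bound (p q s : C) : Re p < 0 -> exists K, forall n,
  expR (Re (p * n%:~R ^+ 2 + q * n%:~R + s)) <= K * expR (- 1) ^+ `|n|%N.
Proof.
move=> p0; exists (expR ((`|Re q| + 1) ^+ 2 / (4 * - Re p) + Re s)) => n.
rewrite -expRM_natl mulrN1 -expRD ler_expR.
have -> : Re (p * n%:~R ^+ 2 + q * n%:~R + s) =
    - (- Re p) * n%:~R ^+ 2 + Re q * n%:~R + Re s.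
  by rewrite !ReD expr2 !ReM ImM intr_complex /= opprK; ring.
apply: le_trans (quadratic_bound _ _ _ _) _; first by rewrite oppr_gt0.
by rewrite natr_absz intr_norm.
Qed.

Definition csum (F : int -> C) (N : nat) : C := \sum_(n <- window N) F n.
Definition climit (F : int -> C) : C :=
  limn (wsum (fun n => Re (F n))) +i* limn (wsum (fun n => Im (F n))).

Lemma gauss_cvg (p q s : C) : Re p < 0 ->
  ccvg (csum (gauss p q s)) (climit (gauss p q s)).
Proof.
move=> /(gauss_bound q s)[K hK]; split; rewrite /csum /=.
  under eq_fun => N do rewrite Re_sum.
  apply: (@wsum_geometric_cvg _ _ K) => n.
  exact: le_trans (Re_cexp_le _) (hK n).
under eq_fun => N do rewrite Im_sum.
apply: (@wsum_geometric_cvg _ _ K) => n.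
exact: le_trans (Im_cexp_le _) (hK n).
Qed.

(** The modulus of each exponential is a function of a times a function of b, so these serve as the
    dominating series of [box_sum_cvg]. *)
Lemma gauss_box_cvg (p q s q' s' : C) (P : nat -> int -> int -> bool) :
  Re p < 0 -> (forall M a b, square M a b -> P M a b) ->
  ccvg (fun M => box_sum M.*2 (P M) (fun a b => gauss p q s a * gauss p q' s'
    b))
    (climit (gauss p q s) * climit (gauss p q' s')).
Proof.
move=> p0 hP; have [K hK] := gauss_bound q s p0.
have [K' hK'] := gauss_bound q' s' p0.
have eM := ccvgM (gauss_cvg q s p0) (gauss_cvg q' s' p0).
pose u n := expR (Re (p * n%:~R ^+ 2 + q * n%:~R + s)).
pose v n := expR (Re (p * n%:~R ^+ 2 + q' * n%:~R + s')).
have cu : cvgn (wsum u).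
  by apply: (@wsum_geometric_cvg _ _ K) => n; rewrite ger0_norm ?expR_ge0 ?hK.
have cv : cvgn (wsum v).
  by apply: (@wsum_geometric_cvg _ _ K') => n; rewrite ger0_norm ?expR_ge0 ?hK'.
have csumM M : csum (gauss p q s) M * csum (gauss p q' s') M =
    \sum_(a <- window M) \sum_(b <- window M) gauss p q s a * gauss p q' s' b.
  by rewrite /csum mulr_suml; apply: eq_bigr => a _; rewrite mulr_sumr.
move: eM; rewrite (funext csumM) => -[e1 e2]; split.
- under eq_fun => M do rewrite /box_sum Re_sum.
  under eq_fun => M do under eq_bigr => a _ do rewrite Re_sum.
  apply: (box_sum_cvg cu cv _ hP) => [a b|].
    by rewrite /gauss -cexpD /u /v -expRD -ReD; exact: Re_cexp_le.
  apply: cvg_trans e1; apply: near_eq_cvg; apply: nearW => M.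
  by rewrite Re_sum; apply: eq_bigr => a _; rewrite Re_sum.
- under eq_fun => M do rewrite /box_sum Im_sum.
  under eq_fun => M do under eq_bigr => a _ do rewrite Im_sum.
  apply: (box_sum_cvg cu cv _ hP) => [a b|].
    by rewrite /gauss -cexpD /u /v -expRD -ReD; exact: Im_cexp_le.
  apply: cvg_trans e2; apply: near_eq_cvg; apply: nearW => M.
  by rewrite Im_sum; apply: eq_bigr => a _; rewrite Im_sum.
Qed.

End ThetaSeries.

(** * Addition formula and Fay's identity for f *)

Section Addition.
Local Open Scope classical_set_scope.
Local Open Scope complex_scope.
Variables (R : realType) (tau : R[i]).
Hypothesis tau_gt0 : 0 < complex.Im tau.
Local Notation C := (R[i]).
Local Notation Re := complex.Re.
Local Notation Im := complex.Im.
Local Notation f := (ef tau).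

Let P : C := 'i * pi%:C * tau.

Let ReP : Re P < 0.
Proof.
rewrite /P; case: tau tau_gt0 => a b /= b0.
rewrite ?(mul0r, mul1r, add0r, oppr0).
by rewrite oppr_lt0 mulr_gt0 ?pi_gt0.
Qed.

Let RePP : Re (P + P) < 0.
Proof. by rewrite ReD; have := ReP; lra. Qed.

(** The summand of 2 f(x) as a series over all integers: the terms n and -1 - n are the two
    exponentials of one sinh. *)
Definition tterm (x : C) (n : int) : C := (-1) ^ n * gauss P (P + 2 * x) x n.

Let sign_Negz n : (-1) ^ Negz n = (-1) ^+ n.+1 :> C.
Proof. by rewrite -[RHS]invr_sign. Qed.

Let fterm_tterm x n :
  fterm tau x n = (tterm x (Posz n) + tterm x (Negz n)) / 2.
Proof.
rewrite /fterm /csinh /tterm /gauss mulrA; congr (_ / _).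
have -> : (-1) ^ (Negz n) = - (-1) ^+ n :> C.
  by rewrite sign_Negz exprS mulN1r.
rewrite -exprnP mulNr -mulrBr -[LHS]mulrA; congr (_ * _).
rewrite mulrBr -!cexpD; congr (cexp _ - cexp _); rewrite /P ?NegzE ?mulrNz
  -!pmulrn.
- rewrite natrM -addn1 -addnn !natrD; ring.
- rewrite natrM -addn1 -addnn !natrD; ring.
Qed.

Let sign_cases (n : int) : (-1) ^ n = 1 :> C \/ (-1) ^ n = -1 :> C.
Proof.
have s (k : nat) : (-1) ^+ k = 1 :> C \/ (-1) ^+ k = -1 :> C.
  by rewrite -signr_odd; case: (odd k); [right | left].
case: n => n; first exact: s.
by rewrite sign_Negz; exact: s.
Qed.

Let signD (m n : int) : (-1) ^ (m + n) = (-1) ^ m * (-1) ^ n :> C.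
Proof. by rewrite expfzDr // oppr_eq0 oner_neq0. Qed.

Let sign_double (n : int) : (-1) ^ (n + n) = 1 :> C.
Proof. by rewrite signD; case: (sign_cases n) => ->; rewrite ?mulr1 ?mulrNN
  ?mulr1. Qed.

Let tterm_bound x : exists K, forall n,
  `|Re (tterm x n)| <= K * expR (- 1) ^+ `|n|%N /\
  `|Im (tterm x n)| <= K * expR (- 1) ^+ `|n|%N.
Proof.
have [K hK] := gauss_bound (P + 2 * x) x ReP; exists K => n; rewrite /tterm.
have h1 := le_trans (Re_cexp_le _) (hK n); have h2 := le_trans (Im_cexp_le _)
  (hK n).
by case: (sign_cases n) => ->; rewrite ?mul1r ?mulN1r ?ReN ?ImN ?normrN.
Qed.

(** The limits in [ef] are meaningful only once convergence is known; the geometric bound on the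
    two-sided terms provides it. *)
Lemma ef_cvg x : ccvg (fun N => \sum_(0 <= n < N) fterm tau x n) (f x).
Proof.
have [K hK] := tterm_bound x.
have half (y : C) : (Re (y / 2) = Re y / 2) * (Im (y / 2) = Im y / 2).
  have -> : y / 2 = y * (2^-1)%:C by rewrite fmorphV rmorph_nat.
  by rewrite ReM ImM /= !mulr0 subr0 add0r.
have K0 n : 0 <= K * expR (- 1) ^+ n.
  by apply: le_trans (normr_ge0 _) (hK n%:Z).1.
have bound (y : R) n : `|y| <= K * expR (- 1) ^+ n ->
    `|y / 2| <= K * expR (- 1) ^+ n.
  move=> hy; rewrite normrM [`|2^-1|]ger0_norm ?invr_ge0 //.
  by apply: le_trans hy; rewrite ler_piMr ?normr_ge0 // invf_le1 ?ler1n.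
split.
- under eq_fun => N do rewrite Re_sum.
  rewrite /ef /=; apply: (_ : cvgn (series _)).
  have -> : series (fun n => Re (fterm tau x n)) = wsum (fun n => Re (tterm x
    n) / 2).
    apply/funext => N; rewrite /wsum big_window; apply: eq_bigr => n _.
    by rewrite fterm_tterm half ReD mulrDl.
  by apply: (@wsum_geometric_cvg _ _ K) => n; apply: bound; case: (hK n).
- under eq_fun => N do rewrite Im_sum.
  rewrite /ef /=; apply: (_ : cvgn (series _)).
  have -> : series (fun n => Im (fterm tau x n)) = wsum (fun n => Im (tterm x
    n) / 2).
    apply/funext => N; rewrite /wsum big_window; apply: eq_bigr => n _.
    by rewrite fterm_tterm half ImD mulrDl.
  by apply: (@wsum_geometric_cvg _ _ K) => n; apply: bound; case: (hK n).
Qed.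

Lemma efN x : f (- x) = - f x.
Proof.
apply: ccvg_unique (ef_cvg _) _; have := ccvgN (ef_cvg x).
congr ccvg; apply/funext => N; rewrite -sumrN; apply: eq_bigr => n _.
by rewrite /fterm /csinh mulrN opprK; ring.
Qed.

(* With q = e^(i pi tau), these are the sums over all integers of
   q^(2a(a+1)) e^(2(2a+1)x) and of q^(2b^2) e^(4bx). *)
Definition theta_odd x := climit (gauss (P + P) (P + P + 4 * x) (2 * x)).
Definition theta_even x := climit (gauss (P + P) (4 * x) 0).

(** For m = a + b and n = a - b the exponent separates into a part in (a, x) and a part in (b, y).
    For n = b - a - 1 the roles of x and y are exchanged and the sign (-1)^(m + n) is -1. *)
Lemma ef_mul x y : 4 * (f (x + y) * f (x - y)) =
  theta_odd x * theta_even y - theta_odd y * theta_even x.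
Proof.
have csum_ef z : ccvg (csum (tterm z)) (2 * f z).
  have -> : csum (tterm z) = fun N => \sum_(0 <= n < N) fterm tau z n
      + \sum_(0 <= n < N) fterm tau z n.
    apply/funext => N; rewrite /csum big_window -big_split; apply: eq_bigr => n
      _.
    by rewrite fterm_tterm /= -splitr.
  by rewrite mulr_natl mulr2n; apply: ccvgD; apply: ef_cvg.
have [h1 h2] := ccvgM (csum_ef (x + y)) (csum_ef (x - y)).
have dbl (u : R^nat) (l : R) : u @ \oo --> l -> (fun M => u M.*2) @ \oo --> l.
  move=> ul; apply: (cvg_comp _ _ _ ul); apply/cvgnyPge => k; near=> n.
  apply: (@leq_trans n); last by rewrite -addnn leq_addr.
  by near: n; exact: nbhs_infty_ge.
(* Windows of size 2M are used because both substitutions map the square of size M in (a, b) into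
   them. *)
have {h1 h2} h : ccvg (fun M => csum (tterm (x + y)) M.*2 * csum (tterm (x -
  y)) M.*2)
    (2 * f (x + y) * (2 * f (x - y))).
  split; first exact: (dbl (fun M => Re (csum _ M * csum _ M))).
  exact: (dbl (fun M => Im (csum _ M * csum _ M))).
have -> : 4 * (f (x + y) * f (x - y)) = 2 * f (x + y) * (2 * f (x - y)) by ring.
apply: ccvg_unique h _.
pose P1 M a b := (a + b \in window M.*2) && (a - b \in window M.*2).
pose P2 M a b := (a + b \in window M.*2) && (b - a - 1 \in window M.*2).
have e1 := @gauss_box_cvg _ (P + P) (P + P + 4 * x) (2 * x) (4 * y) 0 P1 RePP.
have e2 := @gauss_box_cvg _ (P + P) (P + P + 4 * y) (2 * y) (4 * x) 0 P2 RePP.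
have s1 M a b : square M a b -> P1 M a b by rewrite /square /P1 !mem_window;
  lia.
have s2 M a b : square M a b -> P2 M a b by rewrite /square /P2 !mem_window;
  lia.
have := ccvgD (e1 s1) (ccvgN (e2 s2)); congr ccvg; apply/funext => M.
rewrite /csum mulr_suml; under [RHS]eq_bigr => m _ do rewrite mulr_sumr.
rewrite box_sum_parity /box_sum -sumrN; congr (_ + _).
  apply: eq_bigr => a _; apply: eq_bigr => b _.
  rewrite /tterm [RHS]mulrACA -signD (_ : a + b + (a - b) = a + a); last by
    ring.
  rewrite sign_double mul1r /gauss -!cexpD; congr cexp.
  by rewrite intrB !intrD; ring.
apply: eq_bigr => a _; rewrite -sumrN; apply: eq_bigr => b _.
rewrite /tterm [RHS]mulrACA -signD.
rewrite (_ : a + b + (b - a - 1) = b + b + (- 1)); last by ring.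
rewrite signD sign_double mul1r exprN1 invrN1 mulN1r /gauss -!cexpD.
by congr (- cexp _); rewrite !intrB !intrD; ring.
Unshelve. all: end_near.
Qed.

Lemma ef_fay (e p q r : C) :
  f e * f p * f (e + p - q - r) * f (r - q)
  - f (e + p - q) * f q * f (e - r) * f (r - p)
  + f (e + p - r) * f r * f (e - q) * f (q - p) = 0.
Proof.
have n4 : 4 != 0 :> C by rewrite pnatr_eq0.
(* With these half sums the six products of the identity are the six 2 x 2 minors of the vectors
   attached to a, b, c, d. *)
pose a := (e + p) / 2; pose b := (e - p) / 2; pose c := a - q; pose d := a - r.
have two : 2 != 0 :> C by rewrite pnatr_eq0.
pose w x y := theta_odd x * theta_even y - theta_odd y * theta_even x.
have pair u v x y : u = x + y -> v = x - y ->
    4 * (f u * f v) = w x y.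
  by move=> -> ->; exact: ef_mul.
have ab : 4 * (f e * f p) = w a b by apply: (@pair _ _ a b); rewrite /a /b;
  field.
have cd : 4 * (f (e + p - q - r) * f (r - q)) = w c d.
  by apply: (@pair _ _ c d); rewrite /c /d /a; field.
have ac : 4 * (f (e + p - q) * f q) = w a c.
  by apply: (@pair _ _ a c); rewrite /c /a; field.
have bd : 4 * (f (e - r) * f (r - p)) = w b d.
  by apply: (@pair _ _ b d); rewrite /d /a /b; field.
have ad : 4 * (f (e + p - r) * f r) = w a d.
  by apply: (@pair _ _ a d); rewrite /d /a; field.
have bc : 4 * (f (e - q) * f (q - p)) = w b c.
  by apply: (@pair _ _ b c); rewrite /c /a /b; field.
apply: (mulfI n4); apply: (mulfI n4); rewrite !mulr0.
transitivity (4 * (f e * f p) * (4 * (f (e + p - q - r) * f (r - q)))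
  - 4 * (f (e + p - q) * f q) * (4 * (f (e - r) * f (r - p)))
  + 4 * (f (e + p - r) * f r) * (4 * (f (e - q) * f (q - p)))); first by ring.
by rewrite ab cd ac bd ad bc /w; ring.
Qed.
End Addition.

(** * Theta identities from Fay's relations *)

(* Arguments of [f] are quoted as integer linear forms in a list of variables
   and normalized, up to a global sign, so that [field] recognizes equal theta
   factors as equal atoms. *)
Inductive lexp := LVar of nat | LAdd of lexp & lexp | LOpp of lexp.

Section LinForms.
Variable F : fieldType.

Fixpoint leval (xs : seq F) (e : lexp) : F :=
  match e with
  | LVar i => xs`_i
  | LAdd a b => leval xs a + leval xs b
  | LOpp a => - leval xs a
  end.

Fixpoint lin (xs : seq F) (c : seq int) : F :=
  match xs, c with
  | x :: xs', k :: c' => x *~ k + lin xs' c'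
  | _, _ => 0
  end.

Fixpoint vadd (c d : seq int) : seq int :=
  match c, d with
  | k :: c', m :: d' => (k + m) :: vadd c' d'
  | _, _ => [::]
  end.

Fixpoint lnorm (n : nat) (e : lexp) : seq int :=
  match e with
  | LVar i => mkseq (fun j => Posz (j == i)) n
  | LAdd a b => vadd (lnorm n a) (lnorm n b)
  | LOpp a => map -%R (lnorm n a)
  end.

Lemma lin_opp xs c : lin xs (map -%R c) = - lin xs c.
Proof.
elim: xs c => [|x xs IH] [|k c] //=; rewrite ?oppr0 //.
by rewrite IH mulrNz opprD.
Qed.

Lemma lin_vadd xs c d : size c = size xs -> size d = size xs ->
  lin xs (vadd c d) = lin xs c + lin xs d.
Proof.
elim: xs c d => [|x xs IH] [|k c] [|m d] //=; rewrite ?addr0 //.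
by move=> [hc] [hd]; rewrite IH // mulrzDr addrACA.
Qed.

Lemma size_vadd c d : size (vadd c d) = minn (size c) (size d).
Proof.
by elim: c d => [|k c IH] [|m d] //=; rewrite ?minn0 // IH minnSS.
Qed.

Lemma size_lnorm n e : size (lnorm n e) = n.
Proof.
elim: e => [i|a IHa b IHb|a IHa] /=; first by rewrite size_mkseq.
  by rewrite size_vadd IHa IHb minnn.
by rewrite size_map.
Qed.

Lemma lin_unit_out xs m k : (m < k)%N ->
  lin xs [seq Posz (j == m) | j <- iota k (size xs)] = 0.
Proof.
elim: xs k => //= x xs IH k mk.
by rewrite (gtn_eqF mk) mulr0z add0r IH // ltnW.
Qed.

Lemma lin_unit xs m i :
  lin xs [seq Posz (j == (m + i)%N) | j <- iota m (size xs)] = xs`_i.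
Proof.
elim: xs m i => [|x xs IH] m [|i] //=.
  by rewrite addn0 eqxx mulr1z lin_unit_out ?addr0.
by rewrite -[X in X == _]addn0 eqn_add2l mulr0z add0r -(IH m.+1 i) addSnnS.
Qed.

Lemma leval_lnorm xs e : leval xs e = lin xs (lnorm (size xs) e).
Proof.
elim: e => [i|a IHa b IHb|a IHa] /=; first by rewrite -(lin_unit xs 0 i).
  by rewrite IHa IHb lin_vadd ?size_lnorm.
by rewrite lin_opp IHa.
Qed.

(* Every theta identity below is certified as an explicit linear combination of
   instances of Fay's identity; the coefficients were found by linear algebra
   on theta monomials. *)
Lemma lc_nil : (0 : F) = 0. Proof. by []. Qed.
Lemma lc_cons (c e s : F) : e = 0 -> s = 0 -> c * e + s = 0.
Proof. by move=> -> ->; rewrite mulr0 addr0. Qed.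
Lemma lc_eq (s a b : F) : s = 0 -> a - b = s -> a = b.
Proof. by move=> -> /eqP; rewrite subr_eq0 => /eqP. Qed.

End LinForms.

Section Theta.
Variables (F : fieldType) (f : F -> F).
Hypothesis fN : forall x, f (- x) = - f x.
Hypothesis fay : forall e p q r,
  f e * f p * f (e + p - q - r) * f (r - q)
  - f (e + p - q) * f q * f (e - r) * f (r - p)
  + f (e + p - r) * f r * f (e - q) * f (q - p) = 0.

Definition th (xs : seq F) (c : seq int) : F := f (lin xs c).

Lemma f_pos xs e c : lnorm (size xs) e = c -> f (leval xs e) = th xs c.
Proof. by move=> <-; rewrite leval_lnorm. Qed.
Lemma f_neg xs e c : map -%R (lnorm (size xs) e) = c -> f (leval xs e) = - th
  xs c.
Proof. by move=> <-; rewrite leval_lnorm -[RHS]fN /th lin_opp opprK. Qed.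

Ltac lindex x xs :=
  match xs with
  | x :: _ => constr:(0%N)
  | _ :: ?ys => let i := lindex x ys in constr:(S i)
  end.
Ltac lquote xs t :=
  match t with
  | (?a + ?b)%R => let u := lquote xs a in let v := lquote xs b in constr:(LAdd
    u v)
  | (- ?a)%R => let u := lquote xs a in constr:(LOpp u)
  | _ => let i := lindex t xs in constr:(LVar i)
  end.
Ltac isneg c :=
  match c with
  | Posz 0 :: ?d => isneg d
  | Negz _ :: _ => idtac
  end.
Ltac fcanon xs :=
  repeat match goal with
  | |- context [f ?t] =>
     let e := lquote xs t in
     let c := eval vm_compute in (lnorm (size xs) e) in
     first [ isneg c; let d := eval vm_compute in (map -%R c) in
             rewrite ![f t](@f_neg xs e d (erefl _))
           | rewrite ![f t](@f_pos xs e c (erefl _)) ]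
  end.

Ltac nz := repeat (apply/andP; split); first [assumption | done].
(** The nonvanishing hypotheses are normalized together with the goal, so that they match the side
    conditions left by [field]. *)
Ltac fay_field xs :=
  repeat match goal with h : is_true (_ != 0) |- _ => move: h end;
  fcanon xs; rewrite ?oppr_eq0; intros; field; rewrite ?oppr_eq0; nz.

Variable g : F.

(* The weights of the model with [t - g] and [t + g] swapped in [b_+] and [b_-];
   [double_row_gauge] relates the two versions. *)
Definition bp l t := f l * f (t + g) / f t.
Definition bm l t := f l * f (t - g) / f t.
Definition cp l t := f (t - l) * f g / f t.
Definition cm l t := f (t + l) * f g / f t.

(** The R-matrix acting on coefficient functions: [u a b] is the coefficient of e_a ⊗ e_b.
    Exchanging the two arguments gives R_21. *)
Definition face_act (l t : F) (u : bool -> bool -> F) (a b : bool) : F :=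
  match a, b with
  | true, false => bp l t * u true false + cp l t * u false true
  | false, true => cm l t * u true false + bm l t * u false true
  | _, _ => f (l + g) * u a b
  end.

(* The dynamical parameter to the left of a line in state [b], if it is [t] to
   its right. *)
Definition sh (t : F) (b : bool) : F := if b then t - g else t + g.

(** The dynamical Yang-Baxter equation in components. The components +++ and --- agree term by term;
    each of the six others reduces to Fay relations. *)
Lemma dybe x y t (u : bool -> bool -> bool -> F) a b c :
  f t != 0 -> f (t + g) != 0 -> f (t - g) != 0 ->
  face_act x (sh t c) (fun a b => face_act (x + y) t (fun a c =>
    face_act y (sh t a) (fun b c => u a b c) b c) a c) a b =
  face_act y t (fun b c => face_act (x + y) (sh t b) (fun a c =>
    face_act x t (fun a b => u a b c) a b) a c) b c.
Proof.
move=> h1 h2 h3; case: a; case: b; case: c; rewrite /face_act /sh /bp /bm /cp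
  /cm.
- apply: (lc_eq (lc_nil F)).
  by fay_field [:: x; y; t; g].
- apply: (lc_eq (lc_cons (- (u false true true * f g / (f t * f t))) (fay t (y
  + g) (- x + t) y)
    (lc_cons (- (u true false true * f g * f (t + g) / (f t * f (t - g) * f
      t))) (fay t (y - t + g) (- x) y)
    (lc_nil F)))).
  by fay_field [:: x; y; t; g].
- apply: (lc_eq (lc_cons (- (u false true true * f g / (f t * f t))) (fay t (y
  + g) (- x + t) (y + t))
    (lc_cons (u true false true * f g * f g * f g / (f (t - g) * f (t - g) * f
      t * f t)) (fay (t - g) (y + t) (- x + t - g) y)
    (lc_cons (- (u true false true * f y * f x * f (x + y + g) / (f (t - g) * f
      (t - g) * f t * f t))) (fay (t - g) (t - g) (- g) t)
    (lc_cons (- (u true true false * f g / (f (t - g) * f (t - g)))) (fay g y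
      (- x) (y + t))
    (lc_nil F)))))).
  by fay_field [:: x; y; t; g].
- apply: (lc_eq (lc_cons (u false false true * f g / (f (t + g) * f (t + g)))
  (fay (t + g) (y + g) (- x + t + g) y)
    (lc_cons (- (u false true false * f g * f (t + g + g) / (f (t + g) * f t *
      f (t + g)))) (fay g (y + t + g) (- x + t + g) (y + g))
    (lc_nil F)))).
  by fay_field [:: x; y; t; g].
- apply: (lc_eq (lc_cons (- (u true false true * f g * f (t - g - g) / (f (t -
  g) * f (t - g) * f t))) (fay (t - g) (y + g) (- x) y)
    (lc_cons (- (u true true false * f g / (f (t - g) * f (t - g)))) (fay (t -
      g) (y + g) (- x) (y + t - g))
    (lc_nil F)))).
  by fay_field [:: x; y; t; g].
- apply: (lc_eq (lc_cons (u false false true * f g / (f (t + g) * f (t + g)))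
  (fay (t + g) (y - t) (- x) y)
    (lc_cons (- (u false true false * f g * f g * f g / (f (t + g) * f t * f (t
      + g) * f t))) (fay (t + g) (y - t) (- x) (y + t + g))
    (lc_cons (- (u false true false * f y * f x * f (x + y + g) / (f (t + g) *
      f t * f (t + g) * f t))) (fay (t - g) (t + g) (- g) t)
    (lc_cons (u true false false * f g / (f t * f t)) (fay g (y - t) (- x - t)
      (y + g))
    (lc_nil F)))))).
  by fay_field [:: x; y; t; g].
- apply: (lc_eq (lc_cons (- (u false true false * f g * f (t - g) / (f t * f (t
  + g) * f t))) (fay (t + g) (y + t) (- x + t) (y + t + g))
    (lc_cons (- (u true false false * f g / (f t * f t))) (fay (t - g) y (- x -
      g) (y + t))
    (lc_nil F)))).
  by fay_field [:: x; y; t; g].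
- apply: (lc_eq (lc_nil F)).
  by fay_field [:: x; y; t; g].
Qed.

(** * Yang-Baxter and reflection equations *)

Section Reflection.
Variables (W : Type) (Th : W -> F).
Implicit Type T : F -> (bool -> W -> F) -> bool -> W -> F.

(* [Th w] stands for theta - gamma h_W on the basis state [w]. *)
Definition additive_op T := forall l u v,
  T l (fun a w => u a w + v a w) = fun a w => T l u a w + T l v a w.
(** Conservation of h_0 + h_W, expressed as commutation with every function of theta - gamma (h_0 +
    h_W). *)
Definition weight_preserving T := forall l (phi : F -> F) u,
  T l (fun a w => phi (sh (Th w) a) * u a w) =
  fun a w => phi (sh (Th w) a) * T l u a w.

Definition r12 l (v : bool -> bool -> W -> F) a b w :=
  face_act l (Th w) (fun a b => v a b w) a b.
Definition r21 l (v : bool -> bool -> W -> F) a b w :=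
  face_act l (Th w) (fun b a => v a b w) b a.
Definition on1 (X : (bool -> W -> F) -> bool -> W -> F) v
    (a b : bool) (w : W) : F := X (fun a w => v a b w) a w.
Definition on2 (X : (bool -> W -> F) -> bool -> W -> F) v
    (a b : bool) (w : W) : F := X (fun b w => v a b w) b w.

(** The dynamical parameter equals theta at the wall, so [T] receives no shift from the other
    auxiliary line, while both R's carry the shift by W. *)
Definition reflection_eq T := forall l1 l2 v,
  r12 (l1 - l2) (on1 (T l1) (r21 (l1 + l2) (on2 (T l2) v))) =
  on2 (T l2) (r12 (l1 + l2) (on1 (T l1) (r21 (l1 - l2) v))).

Definition Th1 (cw : bool * W) := sh (Th cw.2) cw.1.
(** Sklyanin's dressing R_0c(l - m) T_0(l) R_c0(l + m); the new site c is the one farthest from the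
    wall. *)
Definition dress (m : F) T l (v : bool -> bool * W -> F) a (cw : bool * W) : F
  :=
  face_act (l - m) (Th cw.2) (fun a c =>
    T l (fun a w => face_act (l + m) (Th w) (fun c a => v a (c, w)) c a) a cw.2)
    a cw.1.

(** The R on lines b and c depends on W and a only through the total weight that [T] conserves. *)
Lemma op_face_act T l l' v b c : additive_op T -> weight_preserving T ->
  T l (fun a w => face_act l' (sh (Th w) a) (fun b c => v b c a w) b c) =
  fun a w => face_act l' (sh (Th w) a) (fun b c => T l (v b c) a w) b c.
Proof.
move=> Tadd Tw; case: b; case: c; rewrite /face_act ?Tadd;
  try exact: (Tw l (fun=> f (l' + g))).
  by rewrite (Tw l (bp l')) (Tw l (cp l')).
by rewrite (Tw l (cm l')) (Tw l (bm l')).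
Qed.

End Reflection.

(** Sklyanin's argument: the Yang-Baxter equation carries the crossings of the two auxiliary lines
    past the new site, and [T] on one line commutes with an R on the two others. *)
Lemma dress_reflection (W : Type) (Th : W -> F) m T : (forall w, f (Th w) != 0)
  ->
  (forall w, f (Th w + g) != 0) -> (forall w, f (Th w - g) != 0) ->
  additive_op T -> weight_preserving Th T -> reflection_eq Th T ->
  reflection_eq (Th1 Th) (dress Th m T).
Proof.
move=> h0 hp hm Tadd Tw TR.
pose r12' l (v : bool -> bool -> bool -> W -> F) a b c w :=
  face_act l (sh (Th w) c) (fun a b => v a b c w) a b.
pose r21' l (v : bool -> bool -> bool -> W -> F) a b c w :=
  face_act l (sh (Th w) c) (fun b a => v a b c w) b a.
pose r13 l (v : bool -> bool -> bool -> W -> F) a b c w :=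
  face_act l (Th w) (fun a c => v a b c w) a c.
pose r31 l (v : bool -> bool -> bool -> W -> F) a b c w :=
  face_act l (Th w) (fun c a => v a b c w) c a.
pose r23 l (v : bool -> bool -> bool -> W -> F) a b c w :=
  face_act l (Th w) (fun b c => v a b c w) b c.
pose r32 l (v : bool -> bool -> bool -> W -> F) a b c w :=
  face_act l (Th w) (fun c b => v a b c w) c b.
pose t1 l (v : bool -> bool -> bool -> W -> F) a b c w :=
  T l (fun a w => v a b c w) a w.
pose t2 l (v : bool -> bool -> bool -> W -> F) a b c w :=
  T l (fun b w => v a b c w) b w.
pose q12 l (v : bool -> bool -> bool -> W -> F) a b c w :=
  face_act l (Th w) (fun a b => v a b c w) a b.
pose q21 l (v : bool -> bool -> bool -> W -> F) a b c w :=
  face_act l (Th w) (fun b a => v a b c w) b a.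
pose s13 l (v : bool -> bool -> bool -> W -> F) a b c w :=
  face_act l (sh (Th w) b) (fun a c => v a b c w) a c.
pose s31 l (v : bool -> bool -> bool -> W -> F) a b c w :=
  face_act l (sh (Th w) b) (fun c a => v a b c w) c a.
pose s23 l (v : bool -> bool -> bool -> W -> F) a b c w :=
  face_act l (sh (Th w) a) (fun b c => v a b c w) b c.
pose s32 l (v : bool -> bool -> bool -> W -> F) a b c w :=
  face_act l (sh (Th w) a) (fun c b => v a b c w) c b.
have t1s23 l l' v : t1 l (s23 l' v) = s23 l' (t1 l v).
  apply/funext => a; apply/funext => b; apply/funext => c; apply/funext => w.
  refine (congr1 (fun h => h a w)
    (@op_face_act _ _ T l l' (fun b c a w => v a b c w) b c Tadd Tw)).
have t1s32 l l' v : t1 l (s32 l' v) = s32 l' (t1 l v).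
  apply/funext => a; apply/funext => b; apply/funext => c; apply/funext => w.
  refine (congr1 (fun h => h a w)
    (@op_face_act _ _ T l l' (fun c b a w => v a b c w) c b Tadd Tw)).
have t2s13 l l' v : t2 l (s13 l' v) = s13 l' (t2 l v).
  apply/funext => a; apply/funext => b; apply/funext => c; apply/funext => w.
  refine (congr1 (fun h => h b w)
    (@op_face_act _ _ T l l' (fun a c b w => v a b c w) a c Tadd Tw)).
have t2s31 l l' v : t2 l (s31 l' v) = s31 l' (t2 l v).
  apply/funext => a; apply/funext => b; apply/funext => c; apply/funext => w.
  refine (congr1 (fun h => h b w)
    (@op_face_act _ _ T l l' (fun c a b w => v a b c w) c a Tadd Tw)).
have y123 x y v : r12' x (r13 (x + y) (s23 y v)) = r23 y (s13 (x + y) (q12 x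
  v)).
  apply/funext => a; apply/funext => b; apply/funext => c; apply/funext => w.
  exact: (@dybe x y (Th w) (fun a b c => v a b c w) a b c).
have y231 x y v : r31 y (r21' (x + y) (r23 x v)) = s23 x (q21 (x + y) (s31 y
  v)).
  apply/funext => a; apply/funext => b; apply/funext => c; apply/funext => w.
  by symmetry; apply: (@dybe x y (Th w) (fun b c a => v a b c w) b c a).
have y321 x y v : q21 y (s31 (x + y) (r32 x v)) = s32 x (r31 (x + y) (r21' y
  v)).
  apply/funext => a; apply/funext => b; apply/funext => c; apply/funext => w.
  by symmetry; apply: (@dybe x y (Th w) (fun c b a => v a b c w) c b a).
have y132 x y v : s13 x (q12 (x + y) (s32 y v)) = r32 y (r12' (x + y) (r13 x
  v)).
  apply/funext => a; apply/funext => b; apply/funext => c; apply/funext => w.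
  exact: (@dybe x y (Th w) (fun a c b => v a b c w) a c b).
have re l1 l2 v : q12 (l1 - l2) (t1 l1 (q21 (l1 + l2) (t2 l2 v))) =
    t2 l2 (q12 (l1 + l2) (t1 l1 (q21 (l1 - l2) v))).
  apply/funext => a; apply/funext => b; apply/funext => c; apply/funext => w.
  exact: (congr1 (fun h => h a b w) (TR l1 l2 (fun a b w => v a b c w))).
move=> l1 l2 v.
have key u : r12' (l1 - l2) (r13 (l1 - m) (t1 l1 (r31 (l1 + m)
      (r21' (l1 + l2) (r23 (l2 - m) (t2 l2 (r32 (l2 + m) u))))))) =
    r23 (l2 - m) (t2 l2 (r32 (l2 + m) (r12' (l1 + l2) (r13 (l1 - m)
      (t1 l1 (r31 (l1 + m) (r21' (l1 - l2) u))))))).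
  rewrite (_ : l1 + l2 = (l2 - m) + (l1 + m)); last by ring.
  rewrite y231 t1s23.
  rewrite (_ : l1 - m = (l1 - l2) + (l2 - m)); last by ring.
  rewrite y123 -t2s31.
  rewrite (_ : (l2 - m) + (l1 + m) = l1 + l2); last by ring.
  rewrite re (_ : l1 + m = (l2 + m) + (l1 - l2)); last by ring.
  rewrite y321 t1s32.
  rewrite (_ : l1 + l2 = (l1 - l2 + (l2 - m)) + (l2 + m)); last by ring.
  by rewrite -t2s13 y132.
apply/funext => a; apply/funext => b; apply/funext => -[c w].
exact: (congr1 (fun h => h a b c w) (key (fun a b c w => v a b (c, w)))).
Qed.

(** * The blocks A, B, C, D of a double row operator *)

Section Components.
Variables (W : Type) (Th : W -> F).
Variable T : F -> (bool -> W -> F) -> bool -> W -> F.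
Hypothesis Tadd : additive_op T.
Hypothesis Tw : weight_preserving Th T.
Hypothesis h0 : forall w, f (Th w) != 0.

(* The block of [T] from e_a to e_a' in the auxiliary space: A, B, C, D are the
   pairs (a', a) = (+, +), (+, -), (-, +), (-, -). *)
Definition comp a' a l (u : W -> F) (w : W) : F :=
  T l (fun b w => if b == a then u w else 0) a' w.

Lemma op_comp l v a w :
  T l v a w = comp a true l (v true) w + comp a false l (v false) w.
Proof.
rewrite /comp -[RHS]/((fun a w => _ + _) a w) -Tadd.
congr (T _ _ _ _); apply/funext => b; apply/funext => w'.
by case: b; rewrite ?addr0 ?add0r.
Qed.

Lemma compD a' a l u v w :
  comp a' a l (fun w => u w + v w) w = comp a' a l u w + comp a' a l v w.
Proof.
rewrite /comp -[RHS]/((fun a w => _ + _) a' w) -Tadd.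
congr (T _ _ _ _); apply/funext => b; apply/funext => w'.
by case: eqP; rewrite ?addr0.
Qed.

(** By weight conservation the height of the input is that of [w] corrected for the passage from a
    to a'; the step by [~~ a] cancels the step by [a]. *)
Lemma comp_weight a' a l phi u w :
  comp a' a l (fun w => phi (Th w) * u w) w =
  phi (sh (sh (Th w) a') (~~ a)) * comp a' a l u w.
Proof.
rewrite /comp -[RHS]/((fun b w => phi (sh (sh (Th w) b) (~~ a)) * _) a' w).
rewrite -(Tw l (fun x => phi (sh x (~~ a)))).
congr (T _ _ _ _); apply/funext => b; apply/funext => w'.
case: eqP => [->|]; last by rewrite mulr0.
by case: a; rewrite /sh /= ?subrK ?addrK.
Qed.

Lemma compZ a' a l k u w : comp a' a l (fun w => k * u w) w = k * comp a' a l u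
  w.
Proof. exact: (comp_weight a' a l (fun=> k)). Qed.

Lemma comp0 a' a l w : comp a' a l (fun=> 0) w = 0.
Proof. by have := compZ a' a l 0 (fun=> 0) w; rewrite !mul0r. Qed.

(* The factor on the right may vanish, in which case so does the left hand side;
   working with the divided input avoids this case distinction for B and C. *)
Lemma comp_div a' a l u w :
  comp a' a l u w = f (sh (sh (Th w) a') (~~ a)) *
                    comp a' a l (fun w => u w / f (Th w)) w.
Proof.
rewrite -(comp_weight a' a l f); congr (comp _ _ _ _ _); apply/funext => w'.
by rewrite mulrCA mulfV // mulr1.
Qed.

Lemma comp_face_act a' a l l' v c b w :
  comp a' a l (fun w => face_act l' (Th w) (fun c b => v c b w) c b) w =
  face_act l' (sh (sh (Th w) a') (~~ a)) (fun c b => comp a' a l (v c b) w) c b.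
Proof.
case: c; case: b; rewrite /face_act ?compD ?compZ //.
  by rewrite (comp_weight _ _ _ (bp l')) (comp_weight _ _ _ (cp l')).
by rewrite (comp_weight _ _ _ (cm l')) (comp_weight _ _ _ (bm l')).
Qed.

Lemma comp_phi_div a' a l phi u w :
  comp a' a l (fun w => phi (Th w) / f (Th w) * u w) w =
  phi (sh (sh (Th w) a') (~~ a)) * comp a' a l (fun w => u w / f (Th w)) w.
Proof.
rewrite -comp_weight; congr (comp _ _ _ _ _); apply/funext => w'.
by rewrite mulrAC mulrA.
Qed.

(** The symmetry under l -> - l - g, with denominators cleared so that f (l + l) is allowed to
    vanish. *)
Definition crossing := forall l u w, f (l + l + g) != 0 ->
  [/\ f (l + l + g) * f (Th w + g) * comp false false l u w =
      f (l + l) * f (Th w) * comp true true (- l - g) u w +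
      f g * f (Th w + l + l + g) * comp true true l u w,
      f (l + l) * comp true false (- l - g) u w =
      - f (l + l + g + g) * comp true false l u w &
      f (l + l) * comp false true (- l - g) u w =
      - f (l + l + g + g) * comp false true l u w].

End Components.

(** * Recursion for the blocks when a site is added, and stability of crossing *)

Section DressComponents.
Variables (W : Type) (Th : W -> F).
Variable T : F -> (bool -> W -> F) -> bool -> W -> F.
Hypothesis Tadd : additive_op T.
Hypothesis Tw : weight_preserving Th T.
Hypothesis h0 : forall w, f (Th w) != 0.
Variable m : F.
Local Notation T' := (dress Th m T).
Local Notation A l u w := (comp T true true l u w).
Local Notation B l u w := (comp T true false l u w).
Local Notation C l u w := (comp T false true l u w).
Local Notation D l u w := (comp T false false l u w).
Local Notation slice u c := (fun w => u (c, w)).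
Local Notation slice_div u c := (fun w => u (c, w) / f (Th w)).

(** The factor T R_c0 of the dressed operator, before the outgoing R_0c acts. *)
Let inner a l u c a1 w := T l (fun a2 w => face_act (l + m) (Th w)
  (fun c2 a2 => if a2 == a then u (c2, w) else 0) c a2) a1 w.

Let inner_tt l u a1 w : inner true l u true a1 w =
  f (l + m + g) * comp T a1 true l (slice u true) w +
  comp T a1 false l (fun w => cp (l + m) (Th w) * u (false, w)) w.
Proof.
rewrite /inner (op_comp Tadd) /face_act /= (compZ Tw); congr (_ + comp _ _ _ _
  _ _).
by apply/funext => w'; rewrite mulr0 add0r.
Qed.

Let inner_tf l u a1 w : inner true l u false a1 w =
  comp T a1 true l (fun w => bm (l + m) (Th w) * u (false, w)) w.
Proof.
rewrite /inner (op_comp Tadd) /face_act /= (compZ Tw) (comp0 Tw) mulr0 addr0.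
by congr comp; apply/funext => w'; rewrite mulr0 add0r.
Qed.

Let inner_ft l u a1 w : inner false l u true a1 w =
  comp T a1 false l (fun w => bp (l + m) (Th w) * u (true, w)) w.
Proof.
rewrite /inner (op_comp Tadd) /face_act /= (compZ Tw) (comp0 Tw) mulr0 add0r.
by congr comp; apply/funext => w'; rewrite mulr0 addr0.
Qed.

Let inner_ff l u a1 w : inner false l u false a1 w =
  comp T a1 true l (fun w => cm (l + m) (Th w) * u (true, w)) w +
  f (l + m + g) * comp T a1 false l (slice u false) w.
Proof.
rewrite /inner (op_comp Tadd) /face_act /= (compZ Tw); congr (comp _ _ _ _ _ _
  + _).
by apply/funext => w'; rewrite mulr0 addr0.
Qed.

Lemma comp_dress a' a l u c w : comp T' a' a l u (c, w) =
  face_act (l - m) (Th w) (fun a1 c1 => inner a l u c1 a1 w) a' c.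
Proof. by []. Qed.

(** In these eight recursions B and C, when they occur, act on divided slices: their input height is
    two steps away from [Th w], and f could vanish there. *)
Lemma dressA_true l u w : comp T' true true l u (true, w) =
  f (l - m + g) * (f (l + m + g) * A l (slice u true) w +
    f (Th w - g - g - (l + m)) * f g * B l (slice_div u false) w).
Proof.
rewrite comp_dress /face_act inner_tt.
by rewrite (comp_phi_div Tw _ _ _ (fun t => f (t - (l + m)) * f g)) /sh /=
  ?subrK ?addrK.
Qed.

Lemma dressA_false l u w : comp T' true true l u (false, w) =
  bp (l - m) (Th w) * (bm (l + m) (Th w) * A l (slice u false) w) +
  cp (l - m) (Th w) * (f (l + m + g) * (f (Th w + g + g) * C l (slice_div u
    true) w)
    + cp (l + m) (Th w) * D l (slice u false) w).
Proof.
rewrite comp_dress /face_act inner_tt inner_tf.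
rewrite (comp_weight Tw _ _ _ (bm (l + m))) (comp_weight Tw _ _ _ (cp (l + m))).
by rewrite (comp_div Tw h0 false true) /sh /= ?subrK ?addrK.
Qed.

Lemma dressB_true l u w : comp T' true false l u (true, w) =
  f (l - m + g) *
    (f (l + m) * f (Th w - g - g + g) * B l (slice_div u true) w).
Proof.
rewrite comp_dress /face_act inner_ft.
by rewrite (comp_phi_div Tw _ _ _ (fun t => f (l + m) * f (t + g))) /sh /=
  ?subrK ?addrK.
Qed.

Lemma dressB_false l u w : comp T' true false l u (false, w) =
  bp (l - m) (Th w) * (cm (l + m) (Th w) * A l (slice u true) w +
    f (l + m + g) * (f (Th w - g - g) * B l (slice_div u false) w)) +
  cp (l - m) (Th w) * (bp (l + m) (Th w) * D l (slice u true) w).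
Proof.
rewrite comp_dress /face_act inner_ff inner_ft.
rewrite (comp_weight Tw _ _ _ (bp (l + m))) (comp_weight Tw _ _ _ (cm (l + m))).
by rewrite (comp_div Tw h0 true false) /sh /= ?subrK ?addrK.
Qed.

Lemma dressC_true l u w : comp T' false true l u (true, w) =
  cm (l - m) (Th w) * (bm (l + m) (Th w) * A l (slice u false) w) +
  bm (l - m) (Th w) * (f (l + m + g) * (f (Th w + g + g) * C l (slice_div u
    true) w)
    + cp (l + m) (Th w) * D l (slice u false) w).
Proof.
rewrite comp_dress /face_act inner_tt inner_tf.
rewrite (comp_weight Tw _ _ _ (bm (l + m))) (comp_weight Tw _ _ _ (cp (l + m))).
by rewrite (comp_div Tw h0 false true) /sh /= ?subrK ?addrK.
Qed.

Lemma dressC_false l u w : comp T' false true l u (false, w) =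
  f (l - m + g) *
    (f (l + m) * f (Th w + g + g - g) * C l (slice_div u false) w).
Proof.
rewrite comp_dress /face_act inner_tf.
by rewrite (comp_phi_div Tw _ _ _ (fun t => f (l + m) * f (t - g))) /sh /=
  ?subrK ?addrK.
Qed.

Lemma dressD_true l u w : comp T' false false l u (true, w) =
  cm (l - m) (Th w) * (cm (l + m) (Th w) * A l (slice u true) w +
    f (l + m + g) * (f (Th w - g - g) * B l (slice_div u false) w)) +
  bm (l - m) (Th w) * (bp (l + m) (Th w) * D l (slice u true) w).
Proof.
rewrite comp_dress /face_act inner_ff inner_ft.
rewrite (comp_weight Tw _ _ _ (bp (l + m))) (comp_weight Tw _ _ _ (cm (l + m))).
by rewrite (comp_div Tw h0 true false) /sh /= ?subrK ?addrK.
Qed.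

Lemma dressD_false l u w : comp T' false false l u (false, w) =
  f (l - m + g) * (f (Th w + g + g + (l + m)) * f g * C l (slice_div u true) w +
    f (l + m + g) * D l (slice u false) w).
Proof.
rewrite comp_dress /face_act inner_ff.
by rewrite (comp_phi_div Tw _ _ _ (fun t => f (t + (l + m)) * f g)) /sh /=
  ?subrK ?addrK.
Qed.

Hypothesis hp : forall w, f (Th w + g) != 0.
Hypothesis hm : forall w, f (Th w - g) != 0.
Hypothesis Tcross : crossing Th T.

Lemma dress_crossing : crossing (Th1 Th) T'.
Proof.
move=> l u [c w] hl.
have h0w := h0 w; have hpw := hp w; have hmw := hm w.
(* The map l -> - l - g is an involution, so crossing for [T] is also available at the mirror
   point. *)
have hl' : f (- l - g + (- l - g) + g) != 0.
  by rewrite (_ : - l - g + (- l - g) + g = - (l + l + g)) ?fN ?oppr_eq0 //;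
    ring.
have lK : - (- l - g) - g = l by ring.
have eD v : f (l + l + g) * f (Th w + g) * D l v w -
    (f (l + l) * f (Th w) * A (- l - g) v w +
     f g * f (Th w + l + l + g) * A l v w) = 0.
  by apply/eqP; rewrite subr_eq0; apply/eqP; case: (Tcross v w hl).
have eDc v : f (- l - g + (- l - g) + g) * f (Th w + g) * D (- l - g) v w -
    (f (- l - g + (- l - g)) * f (Th w) * A l v w +
     f g * f (Th w + (- l - g) + (- l - g) + g) * A (- l - g) v w) = 0.
  by apply/eqP; rewrite subr_eq0; apply/eqP; case: (Tcross v w hl'); rewrite lK.
have eBc v : f (l + l) * B (- l - g) v w - - f (l + l + g + g) * B l v w = 0.
  by apply/eqP; rewrite subr_eq0; apply/eqP; case: (Tcross v w hl).
have eCc v : f (l + l) * C (- l - g) v w - - f (l + l + g + g) * C l v w = 0.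
  by apply/eqP; rewrite subr_eq0; apply/eqP; case: (Tcross v w hl).
have eD0 := eD (slice u false); have eD1 := eD (slice u true).
have eDc0 := eDc (slice u false); have eDc1 := eDc (slice u true).
have eBc0 := eBc (slice_div u false); have eBc1 := eBc (slice_div u true).
have eCc0 := eCc (slice_div u false); have eCc1 := eCc (slice_div u true).
(* Six cases: three relations for each state of the new site. Each is a combination of the eight
   relations just prepared for [T] and of Fay relations. *)
rewrite /Th1 /sh; case: c => /=; split.
- rewrite dressD_true !dressA_true /bp /bm /cp /cm; set t := Th w in h0w hpw
  hmw eD0 eD1 eDc0 eDc1 *;
  move: eD0 eD1 eDc0 eDc1 eBc0 eBc1 eCc0 eCc1;
  set A0 := A l (slice u false) w; set A1 := A l (slice u true) w;
  set Ac0 := A (- l - g) (slice u false) w; set Ac1 := A (- l - g) (slice u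
    true) w;
  set B0 := B l (slice_div u false) w; set B1 := B l (slice_div u true) w;
  set Bc0 := B (- l - g) (slice_div u false) w; set Bc1 := B (- l - g)
    (slice_div u true) w;
  set C0 := C l (slice_div u false) w; set C1 := C l (slice_div u true) w;
  set Cc0 := C (- l - g) (slice_div u false) w; set Cc1 := C (- l - g)
    (slice_div u true) w;
  set D0 := D l (slice u false) w; set D1 := D l (slice u true) w;
  set Dc0 := D (- l - g) (slice u false) w; set Dc1 := D (- l - g) (slice u
    true) w;
  move: A0 A1 Ac0 Ac1 B0 B1 Bc0 Bc1 C0 C1 Cc0 Cc1 D0 D1 Dc0 Dc1 => A0 A1 Ac0
    Ac1 B0 B1 Bc0 Bc1 C0 C1 Cc0 Cc1 D0 D1 Dc0 Dc1 eD0 eD1 eDc0 eDc1 eBc0 eBc1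
    eCc0 eCc1.
  apply: (lc_eq (lc_cons ((f (t - g) * f (l + m) * f (l - m + t - g) * f g))
    eBc0
    (lc_cons ((f (l - m) * f (t - g) * f (l + m) / f t)) eD1
    (lc_cons (A1 * f g / f t) (fay g (l - m + t) (- l - m) (l - m + g))
    (lc_cons (B0 * f g) (fay g (l - m + g) (- l - m) (l - m + t))
    (lc_nil F)))))).
  by fay_field [:: l; m; t; g].
- rewrite !dressB_true /bp /bm /cp /cm; set t := Th w in h0w hpw hmw eD0 eD1
  eDc0 eDc1 *;
  move: eD0 eD1 eDc0 eDc1 eBc0 eBc1 eCc0 eCc1;
  set A0 := A l (slice u false) w; set A1 := A l (slice u true) w;
  set Ac0 := A (- l - g) (slice u false) w; set Ac1 := A (- l - g) (slice u
    true) w;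
  set B0 := B l (slice_div u false) w; set B1 := B l (slice_div u true) w;
  set Bc0 := B (- l - g) (slice_div u false) w; set Bc1 := B (- l - g)
    (slice_div u true) w;
  set C0 := C l (slice_div u false) w; set C1 := C l (slice_div u true) w;
  set Cc0 := C (- l - g) (slice_div u false) w; set Cc1 := C (- l - g)
    (slice_div u true) w;
  set D0 := D l (slice u false) w; set D1 := D l (slice u true) w;
  set Dc0 := D (- l - g) (slice u false) w; set Dc1 := D (- l - g) (slice u
    true) w;
  move: A0 A1 Ac0 Ac1 B0 B1 Bc0 Bc1 C0 C1 Cc0 Cc1 D0 D1 Dc0 Dc1 => A0 A1 Ac0
    Ac1 B0 B1 Bc0 Bc1 C0 C1 Cc0 Cc1 D0 D1 Dc0 Dc1 eD0 eD1 eDc0 eDc1 eBc0 eBc1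
    eCc0 eCc1.
  apply: (lc_eq (lc_cons ((f (l + m) * f (l - m + g) * f (t - g))) eBc1
    (lc_nil F))).
  by fay_field [:: l; m; t; g].
- rewrite !dressC_true /bp /bm /cp /cm; set t := Th w in h0w hpw hmw eD0 eD1
  eDc0 eDc1 *;
  move: eD0 eD1 eDc0 eDc1 eBc0 eBc1 eCc0 eCc1;
  set A0 := A l (slice u false) w; set A1 := A l (slice u true) w;
  set Ac0 := A (- l - g) (slice u false) w; set Ac1 := A (- l - g) (slice u
    true) w;
  set B0 := B l (slice_div u false) w; set B1 := B l (slice_div u true) w;
  set Bc0 := B (- l - g) (slice_div u false) w; set Bc1 := B (- l - g)
    (slice_div u true) w;
  set C0 := C l (slice_div u false) w; set C1 := C l (slice_div u true) w;
  set Cc0 := C (- l - g) (slice_div u false) w; set Cc1 := C (- l - g)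
    (slice_div u true) w;
  set D0 := D l (slice u false) w; set D1 := D l (slice u true) w;
  set Dc0 := D (- l - g) (slice u false) w; set Dc1 := D (- l - g) (slice u
    true) w;
  move: A0 A1 Ac0 Ac1 B0 B1 Bc0 Bc1 C0 C1 Cc0 Cc1 D0 D1 Dc0 Dc1 => A0 A1 Ac0
    Ac1 B0 B1 Bc0 Bc1 C0 C1 Cc0 Cc1 D0 D1 Dc0 Dc1 eD0 eD1 eDc0 eDc1 eBc0 eBc1
    eCc0 eCc1.
  apply: (lc_eq (lc_cons ((f (l + m + g) * f (t - g) * f (l - m) * f (t + g +
    g) / f t)) eCc1
    (lc_cons (- (f (l + l + g + g) * f (l - m) * f (t - g) * f (l + m - t) * f
      g / (f t * f t * f (l + l + g) * f (t + g)))) eD0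
    (lc_cons ((f (l + l) * f (l + m + g) * f (t - g) * f (l - m + t + g) * f g
      / (f t * f t * f (l + l + g) * f (t + g)))) eDc0
    (lc_cons (- (A0 * f g * f (t - g) * f (l + l + g + g) / (f t * f t * f (l +
      l + g) * f (t + g)))) (fay t (l - m + t + g) (- l - m + t) (l - m + t))
    (lc_cons (- (Ac0 * f g * f (t - g) * f (l + l) / (f t * f t * f (l + l + g)
      * f (t + g)))) (fay t (l - m) (- l - m + t - g) (l - m + t + g))
    (lc_nil F))))))).
  by fay_field [:: l; m; t; g].
- rewrite dressD_false !dressA_false /bp /bm /cp /cm; set t := Th w in h0w hpw
  hmw eD0 eD1 eDc0 eDc1 *;
  move: eD0 eD1 eDc0 eDc1 eBc0 eBc1 eCc0 eCc1;
  set A0 := A l (slice u false) w; set A1 := A l (slice u true) w;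
  set Ac0 := A (- l - g) (slice u false) w; set Ac1 := A (- l - g) (slice u
    true) w;
  set B0 := B l (slice_div u false) w; set B1 := B l (slice_div u true) w;
  set Bc0 := B (- l - g) (slice_div u false) w; set Bc1 := B (- l - g)
    (slice_div u true) w;
  set C0 := C l (slice_div u false) w; set C1 := C l (slice_div u true) w;
  set Cc0 := C (- l - g) (slice_div u false) w; set Cc1 := C (- l - g)
    (slice_div u true) w;
  set D0 := D l (slice u false) w; set D1 := D l (slice u true) w;
  set Dc0 := D (- l - g) (slice u false) w; set Dc1 := D (- l - g) (slice u
    true) w;
  move: A0 A1 Ac0 Ac1 B0 B1 Bc0 Bc1 C0 C1 Cc0 Cc1 D0 D1 Dc0 Dc1 => A0 A1 Ac0
    Ac1 B0 B1 Bc0 Bc1 C0 C1 Cc0 Cc1 D0 D1 Dc0 Dc1 eD0 eD1 eDc0 eDc1 eBc0 eBc1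
    eCc0 eCc1.
  apply: (lc_eq (lc_cons ((f (t + g) * f (l + m + t + g) * f g * f (l - m) * f
    (t + g + g) / f t)) eCc1
    (lc_cons ((f (t + g + g) * f (l - m + g) * f (l + m + g) / f (t + g)) - (f
      g * f (l + l + t + g + g) * f (l - m - t) * f g * f (l + m - t) * f g /
      (f t * f t * f (l + l + g) * f (t + g)))) eD0
    (lc_cons ((f (l + l) * f (l + m + t + g) * f g * f (l - m + t + g) * f g /
      (f t * f t * f (l + l + g)))) eDc0
    (lc_cons (A0 * f (l - m + g) * f (l + m + g) * f (l + l + t + g) * f g / (f
      t * f t * f (t + g) * f t)) (fay t t (- g) (t + g))
    (lc_cons (- (A0 * f g * f g * f g * f (l + l + t + g) * f g / (f t * f t *
      f (l + l + g) * f (t + g) * f t))) (fay t (l - m - t) (- l - m - g) (l -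
      m + t + g))
    (lc_cons (- (A0 * f g * f (l - m + t + g) * f (l + m + t + g) * f g / (f t
      * f t * f (l + l + g) * f t))) (fay t t (- l - l + t - g) (t + g))
    (lc_cons (- (A0 * f (t - g) * f (t + g) * f g / (f t * f t * f t))) (fay t
      (l - m) (- l - m - g) (l - m + t + g))
    (lc_cons (- (Ac0 * f g * f g * f g * f (l + l) / (f t * f t * f (l + l + g)
      * f (t + g)))) (fay (t + g) (l - m + t + g) (- l - m + t) (l - m + g))
    (lc_cons (Ac0 * f (l - m + g) * f (l + m + g) * f (l + l) / (f t * f t * f
      (t + g))) (fay t t (- g) (t + g))
    (lc_cons (- (C1 * f g * f (t + g + g) / f t)) (fay (t + g) (l - m) (- l - m
      - g) (l - m + g))
    (lc_nil F)))))))))))).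
  by fay_field [:: l; m; t; g].
- rewrite !dressB_false /bp /bm /cp /cm; set t := Th w in h0w hpw hmw eD0 eD1
  eDc0 eDc1 *;
  move: eD0 eD1 eDc0 eDc1 eBc0 eBc1 eCc0 eCc1;
  set A0 := A l (slice u false) w; set A1 := A l (slice u true) w;
  set Ac0 := A (- l - g) (slice u false) w; set Ac1 := A (- l - g) (slice u
    true) w;
  set B0 := B l (slice_div u false) w; set B1 := B l (slice_div u true) w;
  set Bc0 := B (- l - g) (slice_div u false) w; set Bc1 := B (- l - g)
    (slice_div u true) w;
  set C0 := C l (slice_div u false) w; set C1 := C l (slice_div u true) w;
  set Cc0 := C (- l - g) (slice_div u false) w; set Cc1 := C (- l - g)
    (slice_div u true) w;
  set D0 := D l (slice u false) w; set D1 := D l (slice u true) w;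
  set Dc0 := D (- l - g) (slice u false) w; set Dc1 := D (- l - g) (slice u
    true) w;
  move: A0 A1 Ac0 Ac1 B0 B1 Bc0 Bc1 C0 C1 Cc0 Cc1 D0 D1 Dc0 Dc1 => A0 A1 Ac0
    Ac1 B0 B1 Bc0 Bc1 C0 C1 Cc0 Cc1 D0 D1 Dc0 Dc1 eD0 eD1 eDc0 eDc1 eBc0 eBc1
    eCc0 eCc1.
  apply: (lc_eq (lc_cons ((f (l + m + g) * f (t + g) * f (l - m) * f (t - g -
    g) / f t)) eBc0
    (lc_cons (- (f (l + l + g + g) * f (l - m - t) * f g * f (l + m) / (f t * f
      t * f (l + l + g)))) eD1
    (lc_cons ((f (l + l) * f (l + m + t + g) * f g * f (l - m + g) / (f t * f t
      * f (l + l + g)))) eDc1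
    (lc_cons (- (A1 * f g * f (l + l + g + g) / (f t * f t * f (l + l + g))))
      (fay g (l - m - t) (- l - m - t) (l - m + g))
    (lc_cons (- (Ac1 * f g * f (l + l) / (f t * f t * f (l + l + g)))) (fay t
      (l - m - t) (- l - m - g) (l - m + g))
    (lc_nil F))))))).
  by fay_field [:: l; m; t; g].
- rewrite !dressC_false /bp /bm /cp /cm; set t := Th w in h0w hpw hmw eD0 eD1
  eDc0 eDc1 *;
  move: eD0 eD1 eDc0 eDc1 eBc0 eBc1 eCc0 eCc1;
  set A0 := A l (slice u false) w; set A1 := A l (slice u true) w;
  set Ac0 := A (- l - g) (slice u false) w; set Ac1 := A (- l - g) (slice u
    true) w;
  set B0 := B l (slice_div u false) w; set B1 := B l (slice_div u true) w;
  set Bc0 := B (- l - g) (slice_div u false) w; set Bc1 := B (- l - g)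
    (slice_div u true) w;
  set C0 := C l (slice_div u false) w; set C1 := C l (slice_div u true) w;
  set Cc0 := C (- l - g) (slice_div u false) w; set Cc1 := C (- l - g)
    (slice_div u true) w;
  set D0 := D l (slice u false) w; set D1 := D l (slice u true) w;
  set Dc0 := D (- l - g) (slice u false) w; set Dc1 := D (- l - g) (slice u
    true) w;
  move: A0 A1 Ac0 Ac1 B0 B1 Bc0 Bc1 C0 C1 Cc0 Cc1 D0 D1 Dc0 Dc1 => A0 A1 Ac0
    Ac1 B0 B1 Bc0 Bc1 C0 C1 Cc0 Cc1 D0 D1 Dc0 Dc1 eD0 eD1 eDc0 eDc1 eBc0 eBc1
    eCc0 eCc1.
  apply: (lc_eq (lc_cons ((f (l + m) * f (l - m + g) * f (t + g))) eCc0
    (lc_nil F))).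
  by fay_field [:: l; m; t; g].
Qed.

End DressComponents.

Lemma dress_additive (W : Type) (Th : W -> F) m T :
  additive_op T -> additive_op (dress Th m T).
Proof.
move=> Tadd l u v; apply/funext => a; apply/funext => -[c w].
have ractD l' t (x y : bool -> bool -> F) b d :
    face_act l' t (fun b d => x b d + y b d) b d = face_act l' t x b d +
      face_act l' t y b d.
  by case: b; case: d; rewrite /face_act; ring.
rewrite /dress -ractD; congr (face_act _ _ _ _ _).
apply/funext => b; apply/funext => d.
rewrite -[RHS]/((fun b w => _ + _) b w) -Tadd; congr (T _ _ _ _).
by apply/funext => e; apply/funext => w'; rewrite -ractD.
Qed.

(** The ice rule: R conserves the total weight of its two lines, so a function of the height beyond
    both of them factors out. *)
Lemma face_act_sh l t (phi : F -> F) x a c :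
  face_act l t (fun a c => phi (sh (sh t c) a) * x a c) a c =
  phi (sh (sh t c) a) * face_act l t x a c.
Proof.
case: a; case: c; rewrite /face_act /sh ?subrK ?addrK; ring.
Qed.

Lemma dress_weight (W : Type) (Th : W -> F) m T :
  weight_preserving Th T -> weight_preserving (Th1 Th) (dress Th m T).
Proof.
move=> Tw l phi u; apply/funext => a; apply/funext => -[c w].
have shC t b d : sh (sh t b) d = sh (sh t d) b.
  by case: b; case: d; rewrite /sh ?subrK ?addrK.
rewrite /dress /Th1 -[Th (c, w).2]/(Th w) -[(c, w).1]/c /= -face_act_sh.
congr (face_act _ _ _ _ _); apply/funext => b; apply/funext => d.
rewrite shC -[RHS]/((fun b w => phi (sh (sh (Th w) b) d) * _) b w).
rewrite -(Tw l (fun x => phi (sh x d))); congr (T _ _ _ _).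
apply/funext => e; apply/funext => w'; rewrite /= -(face_act_sh _ _ phi).
by congr (face_act _ _ _ _ _); apply/funext => d'; apply/funext => e'; rewrite
  shC.
Qed.

(** * The reflecting end: the chain without sites *)

Section Boundary.
Variables (theta zeta : F).
Let Th (w : unit) := theta.

(* The entries of K are multiplied by [f (theta + zeta + l)], so that the
   crossing l -> - l - g introduces no new denominator. *)
Definition wall_up l := f (zeta + l) * f (theta + zeta - l).
Definition wall_down l := f (zeta - l) * f (theta + zeta + l).
Definition wall_op l (v : bool -> unit -> F) a w :=
  (if a then wall_up l else wall_down l) * v a w.

Lemma wall_additive : additive_op wall_op.
Proof.
by move=> l u v; apply/funext => a; apply/funext => w; rewrite /wall_op mulrDr.
Qed.

Lemma wall_weight : weight_preserving Th wall_op.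
Proof.
by move=> l phi u; apply/funext => a; apply/funext => w; rewrite /wall_op
  mulrCA.
Qed.

(** Since K is diagonal, only the two components with opposite auxiliary states carry content. *)
Lemma wall_reflection : f theta != 0 -> reflection_eq Th wall_op.
Proof.
move=> htheta l1 l2 v; apply/funext => a; apply/funext => b; apply/funext => w.
rewrite /on1 /on2 /r12 /r21 /wall_op /Th; move: htheta; rewrite /wall_up
  /wall_down.
set t := theta; set z := zeta => h.
case: a; case: b; rewrite /face_act /bp /bm /cp /cm.
- apply: (lc_eq (lc_nil F)).
  by fay_field [:: l1; l2; t; z; g].
- apply: (lc_eq (lc_cons (- (v false true w * f (l1 - t - z) * f (l1 + z) * f g
  * f (t + g) / (f t * f t))) (fay (l2 - z) (l2 + t + z) (- l1 + l2) (l2 + l2))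
    (lc_cons (v false true w * f (l1 - z) * f (l1 + t + z) * f g * f (t + g) /
      (f t * f t)) (fay (l2 - z) (l2 + t + z) (- l1 + l2 + t) (l2 + l2))
    (lc_nil F)))).
  by fay_field [:: l1; l2; t; z; g].
- apply: (lc_eq (lc_cons (- (v true false w * f (l1 - t - z) * f (l1 + z) * f g
  * f (t - g) / (f t * f t))) (fay (l2 - t - z) (l2 + z) (- l1 + l2 - t) (l2 +
  l2))
    (lc_cons (- (v true false w * f (l1 - z) * f (l1 + t + z) * f g * f (t - g)
      / (f t * f t))) (fay (l2 - z) (l2 + t + z) (- l1 + l2 + t) (l2 + l2))
    (lc_nil F)))).
  by fay_field [:: l1; l2; t; z; g].
- apply: (lc_eq (lc_nil F)).
  by fay_field [:: l1; l2; t; z; g].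
Qed.

Lemma wall_crossing : crossing Th wall_op.
Proof.
move=> l u w hl; rewrite /comp /wall_op /= /Th /wall_up /wall_down.
set t := theta; set z := zeta; split; last 2 first.
- by rewrite !mulr0.
- by rewrite !mulr0.
apply: (lc_eq (lc_cons (u w) (fay g (l - z - t) (- l - z - t) (l - z + g))
    (lc_nil F))).
by fay_field [:: l; z; t; g].
Qed.

End Boundary.

(** * Exchange relations and Bethe vectors *)

Section Exchange.
Variables (W : Type) (Th : W -> F).
Variable T : F -> (bool -> W -> F) -> bool -> W -> F.
Hypothesis Tadd : additive_op T.
Hypothesis Tw : weight_preserving Th T.
Hypothesis TR : reflection_eq Th T.
Hypothesis Tcross : crossing Th T.
Local Notation A l := (comp T true true l).
Local Notation B l := (comp T true false l).
Local Notation D l := (comp T false false l).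

(* [u] is supported on states of height [t]. *)
Definition of_weight t (u : W -> F) := forall w, (Th w - t) * u w = 0.

Lemma of_weight_fun t u phi : of_weight t u ->
  (fun w => phi (Th w) * u w) = (fun w => phi t * u w).
Proof.
move=> ut; apply/funext => w; have /eqP := ut w.
by rewrite mulf_eq0 subr_eq0 => /orP[/eqP->|/eqP->] //; rewrite !mulr0.
Qed.

Lemma of_weight_comp a' a l t u : of_weight t u ->
  of_weight (sh (sh t (~~ a')) a) (comp T a' a l u).
Proof.
move=> ut w.
have := comp_weight Tw a' a l (fun x => x - t) u w.
rewrite (_ : (fun w => _) = (fun=> 0)); last by apply/funext.
rewrite (comp0 Tw) => /esym.
set x := comp _ _ _ _ _ _; suff -> : sh (sh (Th w) a') (~~ a) - t =
  Th w - sh (sh t (~~ a')) a by [].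
by case: a' a {x} => [] []; rewrite /sh /=; ring.
Qed.

Lemma of_weightA l t u : of_weight t u -> of_weight t (A l u).
Proof.
by move/(of_weight_comp true true l); rewrite /sh /= addrK.
Qed.

Lemma of_weightB l t u : of_weight t u -> of_weight (t + g + g) (B l u).
Proof. exact: (of_weight_comp true false l). Qed.

Lemma of_weightD l t u : of_weight t u -> of_weight t (D l u).
Proof.
by move/(of_weight_comp false false l); rewrite /sh /= subrK.
Qed.

Definition pureb (c d : bool) (u : W -> F) (a b : bool) (w : W) : F :=
  if (a == c) && (b == d) then u w else 0.

Lemma on1E l v a b w : on1 (T l) v a b w =
  comp T a true l (v true b) w + comp T a false l (v false b) w.
Proof. exact: op_comp. Qed.

Lemma on2E l v a b w : on2 (T l) v a b w =
  comp T b true l (v a true) w + comp T b false l (v a false) w.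
Proof. exact: op_comp. Qed.

Lemma on2_pure l c d u : on2 (T l) (pureb c d u) =
  fun a b w => if a == c then comp T b d l u w else 0.
Proof.
apply/funext => a; apply/funext => b; apply/funext => w.
rewrite /on2 /pureb /comp; case: eqP => _ //=.
by rewrite (op_comp Tadd) !(comp0 Tw) addr0.
Qed.

Lemma r21E l v a b : r21 Th l v a b = fun w => face_act l (Th w) (fun b a => v
  a b w) b a.
Proof. by []. Qed.
Lemma r12E l v a b : r12 Th l v a b = fun w => face_act l (Th w) (fun a b => v
  a b w) a b.
Proof. by []. Qed.

Lemma comp_eq0 a' a l u w : (forall w, u w = 0) -> comp T a' a l u w = 0.
Proof.
by move=> u0; rewrite (_ : u = fun=> 0) ?(comp0 Tw) //; apply/funext.
Qed.

Lemma pure00 l1 l u a b :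
  on1 (T l1) (r21 Th l (pureb false false u)) a b =
  fun w => if b then 0 else f (l + g) * comp T a false l1 u w.
Proof.
apply/funext => w; rewrite on1E /r21 /face_act /pureb.
case: b => /=; last first.
  by rewrite (compZ Tw) comp_eq0 ?add0r // => w'; rewrite !mulr0 addr0.
by rewrite !comp_eq0 ?addr0 // => w'; rewrite !mulr0 ?addr0.
Qed.

Lemma pure01 l1 l t u a b : of_weight t u ->
  on1 (T l1) (r21 Th l (pureb false true u)) a b =
  fun w => if b then bp l t * comp T a false l1 u w
           else cm l t * comp T a true l1 u w.
Proof.
move=> ut; apply/funext => w; rewrite on1E /r21 /face_act /pureb.
case: b => /=.
- rewrite (_ : (fun w => f _ * 0) = fun=> 0) ?(comp0 Tw) ?add0r; last first.
    by apply/funext => w'; rewrite mulr0.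
  rewrite -(compZ Tw) -(of_weight_fun _ ut).
  by congr comp; apply/funext => w'; rewrite mulr0 addr0.
- rewrite (_ : (fun w => f _ * 0) = fun=> 0) ?(comp0 Tw) ?addr0; last first.
    by apply/funext => w'; rewrite mulr0.
  rewrite -(compZ Tw) -(of_weight_fun _ ut).
  by congr comp; apply/funext => w'; rewrite mulr0 addr0.
Qed.

(** The ++ component of the reflection equation applied to e_- ⊗ e_- ⊗ u. *)
Lemma B_commute_weak l1 l2 t u w : of_weight t u ->
  f (t + g + g) != 0 -> f (t + g + g + g) != 0 ->
  f (l1 - l2 + g) * f (l1 + l2) * (B l1 (B l2 u) w - B l2 (B l1 u) w) = 0.
Proof.
move=> ut h1 h2.
(* Two B's raise the height by 4 g, so both products vanish at states of any other height. *)
have [hw|hw] := eqVneq (Th w) (t + g + g + g + g); last first.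
  have e0 a b : B a (B b u) w = 0.
    have /eqP := of_weightB a (of_weightB b ut) w.
    by rewrite mulf_eq0 subr_eq0 (negPf hw) => /eqP.
  by rewrite !e0 subrr mulr0.
have := congr1 (fun h => h true true w) (TR l1 l2 (pureb false false u)).
rewrite on2_pure on2E !r12E !(comp_face_act Tadd Tw) /face_act !on1E !r21E.
rewrite !(comp_face_act Tadd Tw) /face_act !pure00 /= !(comp0 Tw) !(compZ Tw)
  hw.
rewrite (_ : _ - g - g = t + g + g) /bp; last by ring.
move=> /eqP; rewrite -subr_eq0 => /eqP hE; apply: (mulIf h2).
apply: (lc_eq (lc_cons (f (t + g + g)) hE (lc_nil F))).
by field.
Qed.

(** [pfac] is the factor in the products of M_0 and of the first term of M_i. For the theta series,
    [pole] is Kronecker's elliptic function up to a constant. [shiftB] and [shiftBc] weigh the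
    unwanted terms of the exchange relation. *)
Definition pfac l u := f (l - u + g) * f (l + u) / (f (l - u) * f (l + u + g)).
Definition pole u v t := f (t + u - v) / (f (u - v) * f t).
Definition shiftB l0 l1 t := f g * f (l1 + l1) * f (t + l1 - l0)
  / (f (l1 + l1 + g) * f (l1 - l0) * f t).
Definition shiftBc l0 l1 t := f g * f (t - g - l1 - l0)
  / (f (l1 + l0 + g) * f t * f (l1 + l1 + g)).

(** The ++ component of the reflection equation on e_- ⊗ e_+ ⊗ u moves A past B at the cost of a D,
    which crossing turns into A at l1 and at - l1 - g. *)
Lemma A_B_exchange l0 l1 t u w : of_weight t u ->
  f t != 0 -> f (t + g) != 0 -> f (l1 - l0) != 0 -> f (l1 + l0 + g) != 0 ->
  f (l1 + l1 + g) != 0 ->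
  A l0 (B l1 u) w =
  pfac l1 l0 * B l1 (A l0 u) w - shiftB l0 l1 (t + g) * B l0 (A l1 u) w
  - shiftBc l0 l1 (t + g) * f (l1 + l1) * B l0 (A (- l1 - g) u) w.
Proof.
rewrite /pfac /shiftB /shiftBc => ut h0 hp h10 h10' h11.
have [hw|hw] := eqVneq (Th w) (t + g + g); last first.
  have e0 v : of_weight (t + g + g) v -> v w = 0.
    move=> /(_ w) /eqP.
    by rewrite mulf_eq0 subr_eq0 (negPf hw) => /eqP.
  rewrite !(e0 (B _ (A _ _))); try by apply: of_weightB; apply: of_weightA.
  rewrite !(e0 (A _ (B _ _))); last by apply: of_weightA; apply: of_weightB.
  by rewrite !mulr0 !subr0.
(* Crossing applied under [B l0]: all vectors there have height t, so the height-dependent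
   coefficients are constants and can be pulled out. *)
have hD : f (l1 + l1 + g) * f (t + g) * B l0 (D l1 u) w
    - (f (l1 + l1) * f t * B l0 (A (- l1 - g) u) w
       + f g * f (t + l1 + l1 + g) * B l0 (A l1 u) w) = 0.
  apply/eqP; rewrite subr_eq0; apply/eqP.
  rewrite -!(compZ Tw) -(compD Tadd); congr comp.
  have of_f v phi : of_weight t v -> forall w, phi t * v w = phi (Th w) * v w.
    by move=> vt w'; have := congr1 (fun h => h w') (of_weight_fun phi vt).
  apply/funext => w'.
  rewrite (of_f _ (fun x => f (l1 + l1 + g) * f (x + g))); last exact:
    of_weightD.
  rewrite (of_f _ (fun x => f (l1 + l1) * f x)); last exact: of_weightA.
  rewrite (of_f _ (fun x => f g * f (x + l1 + l1 + g))); last exact: of_weightA.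
  by case: (Tcross u w' h11).
have := congr1 (fun h => h true true w) (TR l1 l0 (pureb false true u)).
rewrite on2_pure on2E !r12E !(comp_face_act Tadd Tw) /face_act !on1E !r21E.
rewrite !(comp_face_act Tadd Tw) /face_act !(pure01 _ _ _ _ ut) /= !(comp0 Tw)
  !(compZ Tw) hw.
rewrite !addrK /bp /cp /cm.
move/eqP; rewrite -subr_eq0 => /eqP.
move: (B l1 (A l0 u) w) (A l0 (B l1 u) w) (B l0 (A l1 u) w)
  (B l0 (A (- l1 - g) u) w) (B l0 (D l1 u) w) hD => BA AB BA1 BAc BD hD hE.
apply: (lc_eq (lc_cons ((f t / (f (l0 + l1 + g) * f (l0 - l1) * f (t + g)))) hE
    (lc_cons ((f (l0 + l1 - t) * f g / (f (l0 + l1 + g) * f t * f (l1 + l1 + g)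
      * f (t + g)))) hD
    (lc_cons (- (BA1 * f g / (f (l1 + l1 + g) * f (l0 - l1) * f (l0 + l1 + g) *
      f t * f (t + g)))) (fay (t + g) (l1 + l1 + g) (- l0 + l1 + t + g) (l1 +
      l1 + t + g))
    (lc_nil F))))).
by fay_field [:: l0; l1; t; g].
Qed.

(** The three ways of producing B(l0) B(l1) from one more exchange add up: the old coefficient gains
    the factor [pfac l1 u] and its height parameter rises by 2 g. It is needed at u = li and at u =
    - li - g. *)
Lemma bethe_identity l0 l1 u t :
  f t != 0 -> f (t - g) != 0 -> f (t - g - g) != 0 ->
  f (l1 - l0) != 0 -> f (l1 + l0 + g) != 0 -> f (l1 + l1 + g) != 0 ->
  f (u - l0) != 0 -> f (u - l1) != 0 -> f (u + l1 + g) != 0 ->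
  pfac l1 l0 * pole u l0 (t - g - g) - shiftB l0 l1 t * pole u l1 (t - g - g)
  + shiftBc l0 l1 t * f (l1 + l1 + g + g) * pole u (- l1 - g) (t - g - g)
  = pfac l1 u * pole u l0 t.
Proof.
move=> *; rewrite /pfac /pole /shiftB /shiftBc.
apply: (lc_eq (lc_cons (- (f g * f (l0 + l1 - t + g) / (f (l0 + l1 + g) * f (t
  - g - g) * f (l1 + l1 + g) * f t * f (l1 - u) * f (l1 + u + g) * f (t - g))))
  (fay (t - g) (l1 - u) (- l1 - u - g) (l1 - u + g))
    (lc_cons (- (f g * f (l1 - u - t + g + g) / (f (l0 - l1) * f (l0 + l1 + g)
      * f (t - g - g) * f (l1 + l1 + g) * f t * f (l1 - u) * f (t - g)))) (fay
      (t - g) (l1 + l1) (- l0 + l1 + t - g) (l1 + l1 + t))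
    (lc_cons (- (f (l1 - u + g) / (f (l0 + l1 + g) * f (l0 - u) * f t * f (l1 -
      u) * f (l1 + u + g) * f (t - g)))) (fay (t - g) (l1 + u) (- l0 + u + t -
      g) (l1 + u + t))
    (lc_cons (f (l0 + l1) / (f (l0 - l1) * f (l0 + l1 + g) * f (l0 - u) * f (t
      - g - g) * f (l1 - u) * f (t - g))) (fay (t - g) (l1 - u) (- l0 + l1 + t
      - g) (l1 - u + g))
    (lc_nil F)))))).
by fay_field [:: l0; l1; u; t; g].
Qed.

(** * Action of A on Bethe vectors *)

Section Bethe.
Variables (a : F -> F) (vac : W -> F) (tv : F).
Hypothesis vac_weight : of_weight tv vac.
Hypothesis vacA : forall l w, A l vac w = a l * vac w.

Definition bstate (ls : seq F) : W -> F := foldr (fun l u => B l u) vac ls.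

Fixpoint skip i (ls : seq F) :=
  match ls, i with
  | [::], _ => [::]
  | _ :: s, 0%N => s
  | l :: s, i'.+1 => l :: skip i' s
  end.

Lemma size_skip i ls : (i < size ls)%N -> size (skip i ls) = (size ls).-1.
Proof.
elim: ls i => [|l s IH] [|i] //=; rewrite ltnS => hi.
by rewrite IH // prednK // (leq_trans _ hi).
Qed.

(* The two terms are exchanged by li -> - li - g: the second one comes from D
   through crossing. *)
Definition mcoef l0 li rest t :=
  - (f g * f (li + li) / f (li + li + g)) *
  (a li * \prod_(l <- rest) pfac l li * pole li l0 t
   - a (- li - g) * \prod_(l <- rest) pfac l (- li - g) * pole (- li - g) l0 t).

Definition separated l0 l := (f (l - l0) != 0) && (f (l + l0 + g) != 0).

Fixpoint admissible (ls : seq F) :=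
  if ls is l :: s then
    [&& f (l + l + g) != 0, all (separated l) s & admissible s] else true.

(** The mirror map exchanges the two conditions, so the induction in [bethe_action] also applies at
    - l1 - g. *)
Lemma separatedN l l' : separated l l' -> separated (- l - g) l'.
Proof.
rewrite /separated => /andP[h1 h2]; apply/andP; split.
  by rewrite (_ : l' - (- l - g) = l' + l + g) //; ring.
by rewrite (_ : l' + (- l - g) + g = l' - l) //; ring.
Qed.

Lemma bstate_weight ls : of_weight (tv + g *+ (size ls).*2) (bstate ls).
Proof.
elim: ls => [|l s IH] /=; first by rewrite mulr0n addr0.
rewrite doubleS !mulrSr !addrA; exact: of_weightB.
Qed.

Lemma comp_sum (n : nat) a' c l k u (x : 'I_n -> F) (v : 'I_n -> W -> F) w :
  comp T a' c l (fun w => k * u w + \sum_i x i * v i w) w =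
  k * comp T a' c l u w + \sum_i x i * comp T a' c l (v i) w.
Proof.
rewrite (compD Tadd) (compZ Tw); congr (_ + _).
elim: n x v => [|n IH] x v.
  by rewrite big_ord0 comp_eq0 // => w'; rewrite big_ord0.
rewrite big_ord_recl -IH -(compZ Tw) -(compD Tadd); congr comp.
by apply/funext => w'; rewrite big_ord_recl.
Qed.

(** Induction on the list: after one exchange with [B l1], the induction hypothesis is used at l0,
    l1 and - l1 - g. Its leading terms at the last two points form the new coefficient i = 0, and
    its sums recombine by [bethe_identity]. *)
Theorem bethe_action l0 ls w :
  admissible ls -> all (separated l0) ls ->
  (forall k, (k < (size ls).*2)%N -> f (tv + g *+ k) != 0) ->
  A l0 (bstate ls) w =
  a l0 * \prod_(l <- ls) pfac l l0 * bstate ls w +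
  \sum_(i < size ls) mcoef l0 ls`_i (skip i ls) (tv + g *+ (size ls).*2 - g) *
    B l0 (bstate (skip i ls)) w.
Proof.
elim: ls l0 w => [|l1 s IH] l0 w.
  by rewrite big_nil big_ord0 mulr1 addr0 vacA.
rewrite [admissible _]/= => /and3P[h11 sep1 adm] /=/andP[/andP[h10 h10'] sep0]
  htv.
have {}IH l w' : all (separated l) s -> A l (bstate s) w' =
  a l * \prod_(l' <- s) pfac l' l * bstate s w' +
  \sum_(i < size s) mcoef l s`_i (skip i s) (tv + g *+ (size s).*2 - g) *
    B l (bstate (skip i s)) w'.
  move=> sepl; apply: IH => // k hk; apply: htv.
  by apply: leq_trans hk _; rewrite leq_double.
rewrite doubleS !mulrSr addrA addrA addrK.
set t := tv + g *+ (size s).*2 in IH *.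
have ht : f t != 0 by apply: htv; rewrite doubleS.
have htg : f (t + g) != 0.
  by rewrite /t -addrA -mulrSr; apply: htv; rewrite doubleS.
rewrite (A_B_exchange w (bstate_weight s) ht htg h10 h10' h11).
have Afun l : all (separated l) s -> A l (bstate s) = fun w' =>
  a l * \prod_(l' <- s) pfac l' l * bstate s w' +
  \sum_(i < size s) mcoef l s`_i (skip i s) (t - g) * B l (bstate (skip i s))
    w'.
  by move=> sepl; apply/funext => w'; apply: IH.
have sepc : all (separated (- l1 - g)) s.
  by apply: sub_all sep1 => x; apply: separatedN.
rewrite !Afun // !comp_sum big_cons big_ord_recl /=.
(* The three contributions in which an entry of [s] has been consumed combine into a single
   coefficient. *)
have key (i : 'I_(size s)) (Y := bstate (skip i s)) :
    pfac l1 l0 * (mcoef l0 s`_i (skip i s) (t - g) * B l1 (B l0 Y) w)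
    - shiftB l0 l1 (t + g) * (mcoef l1 s`_i (skip i s) (t - g) * B l0 (B l1 Y)
      w)
    - shiftBc l0 l1 (t + g) * f (l1 + l1)
      * (mcoef (- l1 - g) s`_i (skip i s) (t - g) * B l0 (B (- l1 - g) Y) w)
    = mcoef l0 s`_i (l1 :: skip i s) (t + g) * B l0 (B l1 Y) w.
  have hi := ltn_ord i.
  have /andP[i0 i0'] := all_nthP 0 sep0 i hi.
  have /andP[i1 i1'] := all_nthP 0 sep1 i hi.
  have hs : size s = (size s).-1.+1 by rewrite prednK // (leq_trans _ hi).
  have tY : tv + g *+ ((size s).-1).*2 + g + g = t.
    by rewrite /t [in RHS]hs doubleS !mulrSr !addrA.
  (* The list [s] is nonempty here, hence t - g is still one of the heights where f is assumed
     nonzero. *)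
  have htm : f (t - g) != 0.
    rewrite -tY addrK -addrA -mulrSr; apply: htv.
    by rewrite doubleS [X in (_ < X.*2.+2)%N]hs doubleS !ltnS leqW // leqW.
  have wY : of_weight (tv + g *+ ((size s).-1).*2) Y.
    by have := bstate_weight (skip i s); rewrite size_skip.
  (* The numerator of [pfac l1 l0] is exactly the factor under which the two B's are known to
     commute. *)
  have hBB : pfac l1 l0 * B l1 (B l0 Y) w = pfac l1 l0 * B l0 (B l1 Y) w.
    apply/eqP; rewrite -subr_eq0 -mulrBr /pfac mulrAC.
    by rewrite (B_commute_weak l1 l0 w wY) ?mul0r // tY.
  have hBc : f (l1 + l1) * B l0 (B (- l1 - g) Y) w
      = - f (l1 + l1 + g + g) * B l0 (B l1 Y) w.
    rewrite -!(compZ Tw); congr comp; apply/funext => w'.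
    by case: (Tcross Y w' h11).
  have bid u : f (u - l0) != 0 -> f (u - l1) != 0 -> f (u + l1 + g) != 0 ->
      pfac l1 l0 * pole u l0 (t - g) - shiftB l0 l1 (t + g) * pole u l1 (t - g)
      + shiftBc l0 l1 (t + g) * f (l1 + l1 + g + g) * pole u (- l1 - g) (t - g)
      - pfac l1 u * pole u l0 (t + g) = 0.
    move=> u0 u1 u1'; apply/eqP; rewrite subr_eq0; apply/eqP.
    by have := @bethe_identity l0 l1 u (t + g); rewrite !addrK; apply.
  have b1 := bid _ i0 i1 i1'.
  have fneq0 x y : f x != 0 -> y = - x -> f y != 0.
    by move=> hx ->; rewrite fN oppr_eq0.
  (* The same identity at the mirror point - li - g handles the second half of [mcoef]. *)
  have b2 := bid _ (fneq0 _ (- s`_i - g - l0) i0' ltac:(ring))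
    (fneq0 _ (- s`_i - g - l1) i1' ltac:(ring))
    (fneq0 _ (- s`_i - g + l1 + g) i1 ltac:(ring)).
  move: hBB hBc b1 {bid} b2; rewrite /mcoef !big_cons.
  move: (pole _ _ _) (pole _ _ _) (pole _ _ _) (pole _ _ _) (pole _ _ _)
    (pole _ _ _) (pole _ _ _) (pole _ _ _) (shiftB _ _ _) (shiftBc _ _ _)
    => p0 p1 p2 p3 p4 p5 p6 p7 sB sBc.
  move: (f g * f (s`_i + s`_i) / _) (a s`_i) (a (- s`_i - g))
    (B l1 (B l0 Y) w) (B l0 (B l1 Y) w) (B l0 (B (- l1 - g) Y) w)
    => k a1 a2 x y z.
  set P1 := \prod_(l <- _) pfac l s`_i.
  set P2 := \prod_(l <- _) pfac l (- s`_i - g).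
  move: P1 P2 => P1 P2 /eqP; rewrite -subr_eq0 => /eqP hBB.
  move=> /eqP; rewrite -subr_eq0 => /eqP hBc b1 b2.
  apply: (lc_eq (lc_cons (- (k * (a1 * P1 * p7 - a2 * P2 * p3))) hBB
    (lc_cons (sBc * (k * (a1 * P1 * p5 - a2 * P2 * p1))) hBc
    (lc_cons (- (k * a1 * P1 * y)) b1 (lc_cons (k * a2 * P2 * y) b2
    (lc_nil F)))))).
  by ring.
rewrite [X in _ = _ + (_ + X)](eq_bigr _ (fun i _ => esym (key i))).
rewrite !sumrB -!mulr_sumr.
move: (\sum_i _) (\sum_i _) (\sum_i _) => S0 S1 S2.
rewrite /mcoef /pole /shiftB /shiftBc -/t.
set P0 := \prod_(l <- s) pfac l l0; set P1 := \prod_(l <- s) pfac l l1.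
set P2 := \prod_(l <- s) pfac l (- l1 - g).
move: (pfac l1 l0) P0 P1 P2 (B l1 _ w) (B l0 _ w) (a l0) (a l1) (a (- l1 - g))
  => q P0 P1 P2 x y a0 a1 a2.
move: t ht htg h10 h10' h11 {IH Afun key} => t ht htg h10 h10' h11.
apply: (lc_eq (lc_nil F)).
by fay_field [:: l0; l1; t; g].
Qed.

End Bethe.
End Exchange.

(** * Chains of sites *)

Section Chain.
Variables (theta zeta : F).

(** Configurations as nested pairs, so that [dress] adds the head site; the head is the site
    farthest from the wall. *)
Fixpoint chain (ms : seq F) : Type :=
  if ms is _ :: s then (bool * chain s)%type else unit.

Fixpoint height (ms : seq F) : chain ms -> F :=
  match ms with
  | [::] => fun=> theta
  | _ :: s => Th1 (height (ms := s))
  end.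

Fixpoint double_row (ms : seq F) :
    F -> (bool -> chain ms -> F) -> bool -> chain ms -> F :=
  match ms with
  | [::] => wall_op theta zeta
  | m :: s => dress (height (ms := s)) m (double_row (ms := s))
  end.

Fixpoint all_up (ms : seq F) : chain ms -> F :=
  match ms with
  | [::] => fun=> 1
  | _ :: s => fun cw => if cw.1 then all_up cw.2 else 0
  end.

Fixpoint all_down (ms : seq F) : chain ms :=
  match ms with
  | [::] => tt
  | _ :: s => (false, all_down s)
  end.

Lemma height_bound ms (w : chain ms) :
  exists2 k : int, (`|k| <= (size ms)%:Z)%R & height w = theta + g *~ k.
Proof.
elim: ms w => [|m s IH] w; first by exists 0; rewrite ?normr0 // mulr0z addr0.
case: w => c w; have [k hk Ek] := IH w.
rewrite /= /Th1 /= Ek; case: c; rewrite /sh.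
  exists (k - 1); last by rewrite mulrzBr mulr1z addrA.
  by rewrite (le_trans (ler_normB _ _)) // normr1 -addn1 PoszD lerD2r.
exists (k + 1); last by rewrite mulrzDr mulr1z addrA.
by rewrite (le_trans (ler_normD _ _)) // normr1 -addn1 PoszD lerD2r.
Qed.

Definition nonsingular n := forall k : int, (`|k| <= n%:Z)%R ->
  f (theta + g *~ k) != 0.

Lemma nonsingular_le m n : (m <= n)%N -> nonsingular n -> nonsingular m.
Proof. by move=> mn ns k hk; apply: ns; apply: le_trans hk _; rewrite lez_nat.
  Qed.

Lemma height_nz ms (w : chain ms) : nonsingular (size ms) -> f (height w) != 0.
Proof. by move=> ns; have [k hk ->] := height_bound w; apply: ns. Qed.

Lemma height_pm_nz ms (w : chain ms) : nonsingular (size ms).+1 ->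
  f (height w + g) != 0 /\ f (height w - g) != 0.
Proof.
move=> ns; have [k hk ->] := height_bound w; split.
  rewrite -[X in _ + X]mulr1z -addrA -mulrzDr; apply: ns.
  by rewrite (le_trans (ler_normD _ _)) // normr1 -addn1 PoszD lerD2r.
rewrite -[X in _ - X]mulr1z -addrA -mulrzBr; apply: ns.
by rewrite (le_trans (ler_normB _ _)) // normr1 -addn1 PoszD lerD2r.
Qed.

(** Dressing needs f to be nonzero one step beyond the heights of the shorter chain, which is what
    one more unit in [nonsingular] provides. *)
Lemma double_row_props ms : nonsingular (size ms) ->
  [/\ additive_op (double_row (ms := ms)),
      weight_preserving (height (ms := ms)) (double_row (ms := ms)),
      reflection_eq (height (ms := ms)) (double_row (ms := ms)) &
      crossing (height (ms := ms)) (double_row (ms := ms))].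
Proof.
elim: ms => [|m s IH] ns.
  split; [exact: wall_additive | exact: wall_weight | | exact: wall_crossing].
  by apply: wall_reflection; have := ns 0; rewrite mulr0z addr0; apply.
have ns' := nonsingular_le (leqnSn _) ns; have [h1 h2 h3 h4] := IH ns'.
have h0 (w : chain s) := height_nz w ns'.
have hp (w : chain s) := (height_pm_nz w ns).1.
have hm (w : chain s) := (height_pm_nz w ns).2.
split; [exact: dress_additive | exact: dress_weight
  | exact: dress_reflection | exact: dress_crossing].
Qed.

Definition eigA ms l :=
  wall_up theta zeta l * \prod_(m <- ms) (f (l - m + g) * f (l + m + g)).
Definition eigD ms l :=
  wall_down theta zeta l * \prod_(m <- ms) (f (l - m + g) * f (l + m + g)).
(** The crossing relation with A and D exchanged and t replaced by - t, where t is the height of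
    [all_down]. *)
Definition eigAbar ms l :=
  let t := theta + g *+ size ms in
  (f g * f (t - g - (l + l)) * eigD ms l + f (l + l) * f t * eigD ms (- l - g))
  / (f (l + l + g) * f (t - g)).

Lemma all_up_weight ms :
  of_weight (height (ms := ms)) (theta - g *+ size ms) (all_up (ms := ms)).
Proof.
elim: ms => [|m s IH] w /=; first by rewrite mulr0n subr0 subrr mul0r.
case: w => -[] w /=; last by rewrite mulr0.
rewrite /Th1 /sh /= -(IH w) mulrS; congr (_ * _); ring.
Qed.

(** C is carried along in the induction because it enters the recursion of A when the new site is
    down. *)
Lemma comp_all_up ms : nonsingular (size ms) -> forall l w,
  comp (double_row (ms := ms)) true true l (all_up (ms := ms)) w
    = eigA ms l * all_up w /\
  comp (double_row (ms := ms)) false true l (all_up (ms := ms)) w = 0.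
Proof.
elim: ms => [|m s IH] ns l w.
  by rewrite /comp /= /wall_op /= /eigA big_nil !mulr1 mulr0.
have ns' := nonsingular_le (leqnSn _) ns.
have [Tadd Tw _ _] := double_row_props ns'.
have h0 (v : chain s) := height_nz v ns'.
have vf a' a : comp (double_row (ms := s)) a' a l
    (fun v => (all_up (ms := m :: s)) (false, v)) w.2 = 0.
  exact: comp_eq0.
have vfd a' a : comp (double_row (ms := s)) a' a l
    (fun v => (all_up (ms := m :: s)) (false, v) / f (height v)) w.2 = 0.
  by apply: comp_eq0 => // v; rewrite mul0r.
have Cd : comp (double_row (ms := s)) false true l
    (fun v => (all_up (ms := m :: s)) (true, v) / f (height v)) w.2 = 0.
  rewrite (_ : (fun v => _) = fun v => (f (height v))^-1 * all_up v); last
    first.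
    by apply/funext => v /=; rewrite mulrC.
  rewrite (of_weight_fun (fun t => (f t)^-1) (@all_up_weight s)) (compZ Tw).
  by rewrite (IH ns' l w.2).2 mulr0.
case: w vf vfd Cd => -[] w /= vf vfd Cd.
  rewrite (dressA_true Tadd Tw) // (dressC_true Tadd Tw) // vf vfd Cd.
  rewrite (IH ns' l w).1 /eigA big_cons vf; split; ring.
rewrite (dressA_false Tadd Tw) // (dressC_false Tadd Tw) // !vf vfd Cd.
by rewrite ?mulr0 ?addr0 ?mulr0 ?addr0 ?mulr0.
Qed.

(** For a down site, the recursion of A involves A, C and D of the shorter chain; C drops out there,
    so all three are treated together. *)
Lemma comp_all_down ms : nonsingular (size ms) -> forall l u,
  [/\ comp (double_row (ms := ms)) false false l u (all_down ms)
        = eigD ms l * u (all_down ms),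
      comp (double_row (ms := ms)) false true l u (all_down ms) = 0 &
      f (l + l + g) != 0 -> f (theta - g) != 0 ->
      comp (double_row (ms := ms)) true true l u (all_down ms)
        = eigAbar ms l * u (all_down ms)].
Proof.
elim: ms => [|m s IH] ns l u.
  rewrite /comp /= /wall_op /= /eigAbar /eigD !big_nil /= mulr0n addr0 !mulr1.
  split=> //; first by rewrite mulr0.
  rewrite /wall_up /wall_down; move: theta zeta (u tt) => t z v h1 h2.
  apply: (lc_eq (lc_cons (- (v / (f (l + l + g) * f (t - g)))) (fay (t - g) (l
    - z - t) (- l - z - g) (l - z))
    (lc_nil F))).
  by fay_field [:: l; z; t; g].
have ns' := nonsingular_le (leqnSn _) ns.
have [Tadd Tw _ _] := double_row_props ns'.
have h0 (v : chain s) := height_nz v ns'.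
have hdown : height (all_down s) = theta + g *+ size s.
  elim: (s) => [|m' s' IHs] /=; first by rewrite mulr0n addr0.
  by rewrite /Th1 /sh /= IHs mulrSr addrA.
split=> /=.
- rewrite (dressD_false Tadd Tw) //; case: (IH ns' l (fun w => u (false, w)))
  => -> _ _.
  case: (IH ns' l (fun w => u (true, w) / f (height w))) => _ -> _.
  by rewrite /eigD big_cons; ring.
- rewrite (dressC_false Tadd Tw) //.
  by case: (IH ns' l (fun w => u (false, w) / f (height w))) => _ -> _; rewrite
    !mulr0.
move=> h1 h2; rewrite (dressA_false Tadd Tw) //.
case: (IH ns' l (fun w => u (false, w))) => -> _ -> //.
case: (IH ns' l (fun w => u (true, w) / f (height w))) => _ -> _.
have := h0 (all_down s); have [] := height_pm_nz (all_down s) ns.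
rewrite hdown /eigAbar /= mulrSr addrA addrK.
have -> : eigD (m :: s) l = f (l - m + g) * f (l + m + g) * eigD s l.
  by rewrite /eigD big_cons; ring.
have -> : eigD (m :: s) (- l - g) = f (l - m) * f (l + m) * eigD s (- l - g).
  rewrite /eigD big_cons (_ : - l - g - m + g = - (l + m)); last by ring.
  rewrite (_ : - l - g + m + g = - (l - m)) ?fN; last by ring.
  by ring.
move: (theta + g *+ size s) (eigD s l) (eigD s (- l - g)) (u _) => t D Dc v.
rewrite /bp /bm /cp => hp hm ht.
apply: (lc_eq (lc_cons (v * D * f g / (f t * f t * f (l + l + g))) (fay t (l -
  m + g) (- l - m + t) (l - m))
    (lc_nil F))).
by fay_field [:: l; m; t; g].
Qed.

Lemma nonsingular_vac n k : nonsingular n -> (k <= n.*2)%N ->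
  f (theta - g *+ n + g *+ k) != 0.
Proof.
move=> ns hk; have := ns (k%:Z - n%:Z); rewrite mulrzBr -!pmulrn addrCA addrC.
by apply; rewrite ler_norml; lia.
Qed.

Definition partition_fn ms ls :=
  bstate (double_row (ms := ms)) (all_up (ms := ms)) ls (all_down ms).

Lemma partition_fn_eq ms l0 ls :
  (0 < size ms)%N -> size ls = size ms -> nonsingular (size ms) ->
  f (l0 + l0 + g) != 0 -> admissible ls -> all (separated l0) ls ->
  eigAbar ms l0 * partition_fn ms ls =
  eigA ms l0 * \prod_(l <- ls) pfac l l0 * partition_fn ms ls +
  \sum_(i < size ls)
    mcoef (eigA ms) l0 ls`_i (skip i ls) (theta + g *+ (size ms).-1) *
    partition_fn ms (l0 :: skip i ls).
Proof.
move=> ms0 szl ns h0 adm sep.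
have [Tadd Tw TR Tc] := double_row_props ns.
have hth : f (theta - g) != 0.
  have := ns (- 1); rewrite mulrNz mulr1z normrN normr1; apply.
  by rewrite lez_nat.
have [_ _ <- //] := comp_all_down ns l0 (bstate (double_row (ms:=ms)) (all_up
  (ms:=ms)) ls).
rewrite (bethe_action Tadd Tw TR Tc (@all_up_weight ms)
  (fun l w => (comp_all_up ns l w).1)) //; last first.
  by move=> k hk; apply: nonsingular_vac => //; rewrite -szl ltnW.
(* The vacuum has height theta - L g and the L operators B raise it by 2 L g; [mcoef] is taken one
   step below. *)
rewrite szl (_ : _ - g *+ _ + _ - g = theta + g *+ (size ms).-1) //.
case: (size ms) ms0 => // n _; rewrite -addnn mulrnDr [in LHS]mulrSr /=; ring.
Qed.

(** * Return to the gauge of the model *)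

Definition bp0 l t := f l * f (t - g) / f t.
Definition bm0 l t := f l * f (t + g) / f t.

Definition face_act0 (l t : F) (u : bool -> bool -> F) (a b : bool) : F :=
  match a, b with
  | true, false => bp0 l t * u true false + cp l t * u false true
  | false, true => cm l t * u true false + bm0 l t * u false true
  | _, _ => f (l + g) * u a b
  end.

(** A diagonal factor read off the first line on input reappears on output read off the second line;
    this is what exchanges f(t - g) and f(t + g) in the weights. *)
Lemma face_act_gauge l t x a b :
  face_act l t (fun a b => f (sh t a) * x a b) a b = f (sh t b) * face_act0 l t
    x a b.
Proof.
by case: a; case: b; rewrite /face_act /face_act0 /sh /bp /bm /bp0 /bm0; ring.
Qed.

Fixpoint double_row0 (ms : seq F) :
    F -> (bool -> chain ms -> F) -> bool -> chain ms -> F :=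
  match ms with
  | [::] => wall_op theta zeta
  | m :: s => fun l v a cw =>
      face_act0 (l - m) (height cw.2) (fun a c =>
        double_row0 l (fun a w =>
          face_act0 (l + m) (height w) (fun c a => v a (c, w)) c a) a cw.2) a
            cw.1
  end.

Fixpoint gauge (ms : seq F) : chain ms -> F :=
  match ms with
  | [::] => fun=> 1
  | _ :: s => fun cw => f (sh (height cw.2) cw.1) * gauge cw.2
  end.

Lemma gauge_nz ms (w : chain ms) : nonsingular (size ms) -> gauge w != 0.
Proof.
elim: ms w => [|m s IH] w ns; first exact: oner_neq0.
rewrite /= mulf_neq0 //; first exact: (@height_nz (m :: s) w ns).
by apply: IH; apply: nonsingular_le ns.
Qed.

(** R_c0 transfers the gauge factor of site c to the auxiliary line, weight conservation carries it
    through the inner operator, and R_0c returns it to the site. *)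
Lemma double_row_gauge ms l v a (w : chain ms) : nonsingular (size ms) ->
  double_row l (fun a w => gauge w * v a w) a w = gauge w * double_row0 l v a w.
Proof.
elim: ms v a w => [|m s IH] v a w ns; first by rewrite /= /wall_op !mul1r.
have ns' := nonsingular_le (leqnSn _) ns.
have [_ Tw _ _] := double_row_props ns'.
case: w => c w; rewrite /= /dress /=.
have ract0Z l' t k x p q : face_act0 l' t (fun p q => k * x p q) p q
    = k * face_act0 l' t x p q.
  by case: p; case: q; rewrite /face_act0; ring.
have inner p q : double_row l (fun a w => face_act (l + m) (height w)
      (fun c a => f (sh (height w) c) * gauge w * v a (c, w)) q a) p w =
    f (sh (height w) p) * (gauge w * double_row0 l (fun a w =>
      face_act0 (l + m) (height w) (fun c a => v a (c, w)) q a) p w).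
  rewrite -IH // -[RHS]/((fun p w => f (sh (height w) p) * _) p w) -Tw.
  congr (double_row _ _ _ _); apply/funext => d; apply/funext => y.
  rewrite -ract0Z -face_act_gauge; congr (face_act _ _ _ _ _).
  by apply/funext => e; apply/funext => b; rewrite mulrA.
transitivity (face_act (l - m) (height w) (fun a c => f (sh (height w) a) *
    (gauge w * double_row0 l (fun a w => face_act0 (l + m) (height w)
      (fun c a => v a (c, w)) c a) a w)) a c).
  by congr (face_act _ _ _ _ _); apply/funext => p; apply/funext => q; apply:
    inner.
by rewrite face_act_gauge ract0Z mulrA.
Qed.

Definition partition_fn0 ms ls :=
  bstate (double_row0 (ms := ms)) (all_up (ms := ms)) ls (all_down ms).

Fixpoint chain_up (ms : seq F) : chain ms :=
  match ms with
  | [::] => tt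
  | _ :: s => (true, chain_up s)
  end.

Lemma gauge_all_up ms (w : chain ms) :
  gauge w * all_up w = gauge (chain_up ms) * all_up w.
Proof.
suff : all_up w = 0 \/ w = chain_up ms by move=> [->|->] //; rewrite !mulr0.
elim: ms w => [|m s IH] w /=; first by right; case: w.
case: w => -[] w /=; last by left.
by case: (IH w) => [->|->]; [left | right].
Qed.

(** Both gauge factors are independent of the spectral parameters, so linear relations among
    partition functions pass from one gauge to the other. *)
Lemma partition_fn_gauge ms ls : nonsingular (size ms) ->
  gauge (all_down ms) * partition_fn0 ms ls =
  gauge (chain_up ms) * partition_fn ms ls.
Proof.
move=> ns; rewrite /partition_fn /partition_fn0.
have [Tadd Tw _ _] := double_row_props ns.
elim: ls (all_down ms) => [|l ls IH] w /=; first exact: gauge_all_up.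
rewrite -(compZ Tw) /comp -double_row_gauge //; congr (double_row _ _ _ _).
apply/funext => a; apply/funext => y; case: eqP => _; last by rewrite mulr0.
exact: IH.
Qed.

Lemma partition_fn0_eq ms l0 ls :
  (0 < size ms)%N -> size ls = size ms -> nonsingular (size ms) ->
  f (l0 + l0 + g) != 0 -> admissible ls -> all (separated l0) ls ->
  eigAbar ms l0 * partition_fn0 ms ls =
  eigA ms l0 * \prod_(l <- ls) pfac l l0 * partition_fn0 ms ls +
  \sum_(i < size ls)
    mcoef (eigA ms) l0 ls`_i (skip i ls) (theta + g *+ (size ms).-1) *
    partition_fn0 ms (l0 :: skip i ls).
Proof.
move=> ms0 szl ns h0 adm sep.
have gd := gauge_nz (all_down ms) ns.
apply: (mulfI gd); rewrite mulrCA partition_fn_gauge // [LHS]mulrCA.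
rewrite (partition_fn_eq ms0 szl ns h0 adm sep) !mulrDr; congr (_ + _).
  by rewrite mulrCA -partition_fn_gauge // mulrCA.
rewrite !mulr_sumr; apply: eq_bigr => i _.
by rewrite mulrCA -partition_fn_gauge // mulrCA.
Qed.

End Chain.

(** * Identification with the coefficients of the statement *)

Lemma weight_i_expand t z d li l0 Pa Pd P1 P2 :
  f (t + z + li) != 0 -> f (li + li + g) != 0 -> f (li - l0) != 0 ->
  f (li + l0 + g) != 0 -> f (t + d) != 0 -> f (t - d) != 0 ->
  f (t - (d + g)) != 0 ->
  f (t + z + li) *
    (f (li + li) * f g * f (t + d + li - l0)
      / (f (li + li + g) * f (li - l0) * f (t + d))
      * (f (z + li) * f (t + z - li) / f (t + z + li) * Pa) * P1 +
     f g * f (t + (d - g) - li - l0) * f (t - d)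
      / (f (li + l0 + g) * f (t + d) * f (t - (d + g)))
      * (f (z - li - g) * (f (li + li) * f (t + z + li + g) * f (t - (d + g)))
          / (f (li + li + g) * f (t + z + li) * f (t - d)) * Pd) * P2) =
  - (- (f g * f (li + li) / f (li + li + g)) *
      (wall_up t z li * Pa * P1 * pole li l0 (t + d)
       - wall_up t z (- li - g) * Pd * P2 * pole (- li - g) l0 (t + d))).
Proof.
move=> *; rewrite /wall_up /pole; apply: (lc_eq (lc_nil F)).
by fay_field [:: li; l0; t; z; d; g].
Qed.

(** Here d stands for (L - 1) g, and [Pa], [Pd] for the products over sites at l and at its mirror
    point; the prefactor clears the denominator of K. *)
Lemma eigAbar_expand t z d l Pa Pd :
  f (t + z + l) != 0 -> f (l + l + g) != 0 -> f (t + d) != 0 ->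
  f (t + z + l) *
    (f (z - l) * (f g * f (t + d - (l + l))) / (f (l + l + g) * f (t + d)) * Pa
     + f (z + l + g) * (f (l + l) * f (t + z - l - g) * f (t + (d + g)))
       / (f (l + l + g) * f (t + z + l) * f (t + d)) * Pd) =
  (f g * f (t + (d + g) - g - (l + l)) * (wall_down t z l * Pa)
   + f (l + l) * f (t + (d + g)) * (wall_down t z (- l - g) * Pd))
  / (f (l + l + g) * f (t + (d + g) - g)).
Proof.
move=> *; rewrite /wall_down; apply: (lc_eq (lc_nil F)).
by fay_field [:: l; t; z; d; g].
Qed.

Lemma nth_skip (x : F) i (s : seq F) k :
  nth x (skip i s) k = nth x s (bump i k).
Proof.
elim: s i k => [|y s IH] [|i] [|k] //=; first by rewrite nth_nil.
by rewrite IH bumpS.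
Qed.

Lemma skip_enum n (h : 'I_n.+1 -> F) (i : 'I_n.+1) :
  skip i [seq h k | k <- enum 'I_n.+1] = [seq h (lift i k) | k <- enum 'I_n].
Proof.
have hi : (i < size [seq h k | k <- enum 'I_n.+1])%N.
  by rewrite size_map size_enum_ord.
apply: (@eq_from_nth _ 0) => [|k].
  by rewrite size_skip // (size_map h) (size_map (fun k => h (lift i k)))
    !size_enum_ord.
rewrite size_skip // size_map size_enum_ord /= => kn.
rewrite nth_skip (nth_map ord0) ?size_enum_ord; last exact: (ltn_ord (lift i
  (Ordinal kn))).
rewrite (nth_map (Ordinal kn)) ?size_enum_ord //; congr h; apply: val_inj.
by rewrite /= !nth_enum_ord //; exact: (ltn_ord (lift i (Ordinal kn))).
Qed.

Lemma prod_skip n (G : F -> F) (h : 'I_n -> F) (i : 'I_n) :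
  \prod_(x <- skip i [seq h k | k <- enum 'I_n]) G x =
  \prod_(j < n | j != i) G (h j).
Proof.
case: n h i => [h []//|n h i]; rewrite skip_enum big_map big_enum /=.
rewrite [RHS](reindex_omap (lift i) (unlift i)) /=; last first.
  by move=> j; case: unliftP => [k ->|->]; rewrite ?eqxx.
by apply: eq_bigl => k; rewrite liftK eqxx lift_eqF.
Qed.

Lemma prod_enum n (G : F -> F) (h : 'I_n -> F) :
  \prod_(x <- [seq h k | k <- enum 'I_n]) G x = \prod_k G (h k).
Proof. by rewrite big_map big_enum. Qed.

Lemma admissible_map (I : eqType) (h : I -> F) (s : seq I) : uniq s ->
  (forall i, f (h i + h i + g) != 0) ->
  (forall i j, i != j -> separated (h i) (h j)) ->
  admissible [seq h i | i <- s].
Proof.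
move=> + h2 hs; elim: s => //= i s IH /andP[iNs us].
rewrite h2 IH // andbT /=; apply/allP => _ /mapP[j js ->]; apply: hs.
by apply: contraNneq iNs => ->.
Qed.

(** Omitting an entry other than the first leaves the first entry in front, as in the vectors with
    l0 prepended that [bethe_action] produces. *)
Lemma enum_lift_cons n (h : 'I_n.+1 -> F) (i : 'I_n) :
  [seq h (lift (lift ord0 i) k) | k <- enum 'I_n] =
  h ord0 :: skip i [seq h (lift ord0 k) | k <- enum 'I_n].
Proof.
case: n h i => [h []//|n h i].
rewrite (skip_enum (fun k => h (lift ord0 k))) enum_ordSl /= -map_comp.
congr (h _ :: _); first exact: val_inj.
by apply: eq_map => k /=; congr h; apply: val_inj; rewrite /= bumpS.
Qed.

Section Weights.
Variables (t z : F) (L : nat) (mu : 'I_L -> F).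
Local Notation ms := [seq mu j | j <- enum 'I_L].
Local Notation H l := (f (t + z + l)).

(** By oddness the mirror point turns the site factors shifted by gamma into the unshifted ones. *)
Lemma prod_mirror l : \prod_(m <- ms) (f (- l - g - m + g) * f (- l - g + m +
  g)) =
  \prod_(j < L) (f (l - mu j) * f (l + mu j)).
Proof.
rewrite prod_enum; apply: eq_bigr => j _.
rewrite (_ : - l - g - mu j + g = - (l + mu j)); last by ring.
rewrite (_ : - l - g + mu j + g = - (l - mu j)); last by ring.
by rewrite !fN mulrNN mulrC.
Qed.

Let d := (L%:R - 1) * g.
Let dg : L%:R * g = d + g. Proof. by rewrite /d; ring. Qed.
Let d2 : (L%:R - 2) * g = d - g. Proof. by rewrite /d; ring. Qed.
Let dn : (0 < L)%N -> g *+ L.-1 = d.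
Proof. by move=> L0; rewrite /d -[in RHS](prednK L0) -natr1 addrK mulr_natl.
  Qed.

Lemma eigAbar_formula l : H l != 0 -> f (l + l + g) != 0 ->
  f (t + (L%:R - 1) * g) != 0 ->
  H l *
  (f (z - l) * (f g * f (t + (L%:R - 1) * g - 2 * l))
     / (f (2 * l + g) * f (t + (L%:R - 1) * g))
     * \prod_(j < L) (f (l - mu j + g) * f (l + mu j + g))
   + f (z + l + g) * (f (2 * l) * f (t + z - l - g) * f (t + L%:R * g))
     / (f (2 * l + g) * H l * f (t + (L%:R - 1) * g))
     * \prod_(j < L) (f (l - mu j) * f (l + mu j))) =
  eigAbar t z ms l.
Proof.
move=> hH hl hd; rewrite /eigAbar /eigD prod_mirror prod_enum.
rewrite size_map size_enum_ord -[g *+ L]mulr_natl -/d dg !mulr_natl !mulr2n.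
exact: eigAbar_expand.
Qed.

Lemma eigA_formula l : H l != 0 ->
  H l * (f (z + l) * f (t + z - l) / H l
         * \prod_(j < L) (f (l - mu j + g) * f (l + mu j + g))) =
  eigA t z ms l.
Proof.
move=> hH; rewrite /eigA /wall_up prod_enum mulrA; congr (_ * _).
by rewrite mulrC divfK.
Qed.

Lemma mcoef_formula l0 (lams : 'I_L -> F) (i : 'I_L) (li := lams i) :
  (0 < L)%N -> f (t + (L%:R - 1) * g) != 0 -> f (t - (L%:R - 1) * g) != 0 ->
  f (t - L%:R * g) != 0 ->
  H li != 0 -> f (li + li + g) != 0 -> f (li - l0) != 0 ->
  f (li + l0 + g) != 0 ->
  H li *
  ((f (2 * li) * f g * f (t + (L%:R - 1) * g + li - l0))
     / (f (2 * li + g) * f (li - l0) * f (t + (L%:R - 1) * g))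
   * (f (z + li) * f (t + z - li) / H li
      * \prod_(j < L) (f (li - mu j + g) * f (li + mu j + g)))
   * \prod_(j < L | j != i)
       ((f (lams j - li + g) * f (lams j + li))
        / (f (lams j - li) * f (lams j + li + g)))
   + (f g * f (t + (L%:R - 2) * g - li - l0) * f (t - (L%:R - 1) * g))
     / (f (li + l0 + g) * f (t + (L%:R - 1) * g) * f (t - L%:R * g))
   * (f (z - li - g) * (f (2 * li) * f (t + z + li + g) * f (t - L%:R * g))
      / (f (2 * li + g) * H li * f (t - (L%:R - 1) * g))
      * \prod_(j < L) (f (li - mu j) * f (li + mu j)))
   * \prod_(j < L | j != i)
       ((f (li - lams j + g) * f (li + lams j + 2 * g))
        / (f (li - lams j) * f (li + lams j + g)))) =
  - mcoef (eigA t z ms) l0 li (skip i [seq lams k | k <- enum 'I_L])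
      (t + g *+ L.-1).
Proof.
move=> L0 h1 h2 h3 h4 h5 h6 h7.
rewrite /mcoef /eigA prod_mirror prod_enum !prod_skip.
rewrite dn // -/d dg d2 !mulr_natl !mulr2n in h1 h2 h3 *.
rewrite -weight_i_expand //; congr (_ * (_ + _ * _)).
apply: eq_bigr => j _; rewrite /pfac.
(* The first product of M_i taken at the mirror point is the second one, once its four arguments are
   rewritten and the signs cancel. *)
rewrite (_ : lams j - (- li - g) + g = li + lams j + (g + g)); last by ring.
rewrite (_ : lams j + (- li - g) = - (li - lams j + g)); last by ring.
rewrite (_ : lams j - (- li - g) = li + lams j + g); last by ring.
rewrite (_ : - (li - lams j + g) + g = - (li - lams j)); last by ring.
rewrite !fN !mulrN invrN mulrNN; congr (_ / _); exact: mulrC.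
Qed.

End Weights.
End Theta.

(** * The model of the statement *)

Section Transfer.
Local Open Scope complex_scope.
Variables (R : realType) (tau gamma theta zeta : R[i]) (L : nat).
Variable mu : 'I_L -> R[i].
Local Notation C := (R[i]).
Local Notation f := (ef tau).
Local Notation W := (Wst L).

Definition mact (S : finType) (M : S -> S -> C) (v : S -> C) (x : S) : C :=
  \sum_y M x y * v y.

Lemma mact_opmul (S : finType) (M N : S -> S -> C) v x :
  mact (opmul M N) v x = mact M (mact N v) x.
Proof.
rewrite /mact /opmul; under eq_bigr => y _ do rewrite mulr_suml.
rewrite exchange_big; apply: eq_bigr => z _; rewrite mulr_sumr.
by apply: eq_bigr => y _; rewrite mulrA.
Qed.

Lemma mact_opid (S : finType) (v : S -> C) x : mact (@opid R S) v x = v x.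
Proof.
rewrite /mact /opid (bigD1 x) //= eqxx mul1r big1 ?addr0 // => y yx.
by rewrite eq_sym (negPf yx) mul0r.
Qed.

Lemma mact_opprod (S : finType) (s : seq (S -> S -> C)) v :
  mact (opprod s) v = foldr (fun M => mact M) v s.
Proof.
apply/funext => x; elim: s x => [|M s IH] x /=; first exact: mact_opid.
by rewrite mact_opmul; congr mact; apply/funext.
Qed.

Definition upd (s : W) (j : 'I_L) (c : bool) : W :=
  [ffun k => if k == j then c else s k].

(** Only configurations agreeing with [s] away from j contribute, so the sum over W collapses to one
    over the local state. *)
Lemma mact_site (M : bool -> bool -> bool -> bool -> W -> C) (j : 'I_L)
    (v : St L -> C) a s :
  (forall o1 o2 i1 i2 c, M o1 o2 i1 i2 (upd s j c) = M o1 o2 i1 i2 s) ->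
  mact (fun x y : St L => if [forall k, (k != j) ==> (x.2 k == y.2 k)]
    then M x.1 (x.2 j) y.1 (y.2 j) y.2 else 0) v (a, s) =
  \sum_b \sum_c M a (s j) b c s * v (b, upd s j c).
Proof.
move=> hM; rewrite /mact.
rewrite (eq_bigr (fun y : St L => (fun b (y : W) => (if [forall k, (k != j) ==>
  (s k == y k)]
  then M a (s j) b (y j) y else 0) * v (b, y)) y.1 y.2)); last by case.
rewrite -(pair_bigA _ (fun b (y : W) => (if [forall k, (k != j) ==> (s k == y
  k)] then M a (s j) b (y j) y else 0) * v (b, y))) /=; apply: eq_bigr => b _.
rewrite (bigID (fun y : W => [forall k, (k != j) ==> (s k == y k)])) /=.
rewrite [X in _ + X]big1 ?addr0; last by move=> y /negPf ->; rewrite mul0r.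
rewrite (reindex_onto (upd s j) (fun y : W => y j)) /=; last first.
  move=> y /forallP sy; apply/ffunP => k; rewrite ffunE; case: eqP =>
    [->//|/eqP kj].
  by have /implyP/(_ kj)/eqP := sy k.
apply: eq_big => [c|c /andP[h _]].
  rewrite ffunE eqxx eqxx andbT; apply/forallP => k.
  by rewrite ffunE; case: eqP => //=.
by rewrite h hM ffunE eqxx.
Qed.

Lemma mactZ (S : finType) (M : S -> S -> C) k v x :
  mact M (fun y => k * v y) x = k * mact M v x.
Proof. by rewrite /mact mulr_sumr; apply: eq_bigr => y _; rewrite mulrCA. Qed.

Lemma updE s j c k : upd s j c k = if k == j then c else s k.
Proof. by rewrite ffunE. Qed.

Lemma dynth_upd j s c : dynth gamma theta j (upd s j c) = dynth gamma theta j s.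
Proof.
congr (_ - _ * _); apply: eq_bigr => i ji.
by rewrite updE; case: eqP ji => // ->; rewrite ltnn.
Qed.

Lemma mact_R0j l j v a s : mact (R0j tau gamma l theta j) v (a, s) =
  face_act0 f gamma l (dynth gamma theta j s) (fun a c => v (a, upd s j c)) a
    (s j).
Proof.
rewrite (@mact_site (fun o1 o2 i1 i2 y =>
  Rmat tau gamma l (dynth gamma theta j y) o1 o2 i1 i2)); last first.
  by move=> *; rewrite dynth_upd.
rewrite !big_bool /Rmat; case: a; case: (s j) => /=;
  by rewrite ?mul0r ?addr0 ?add0r /bp0 /bm0 /cp /cm.
Qed.

Lemma mact_Rj0 l j v a s : mact (Rj0 tau gamma l theta j) v (a, s) =
  face_act0 f gamma l (dynth gamma theta j s) (fun c a => v (a, upd s j c)) (s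
    j) a.
Proof.
rewrite (@mact_site (fun o1 o2 i1 i2 y =>
  Rmat tau gamma l (dynth gamma theta j y) o2 o1 i2 i1)); last first.
  by move=> *; rewrite dynth_upd.
rewrite !big_bool /Rmat; case: a; case: (s j) => /=;
  by rewrite ?mul0r ?addr0 ?add0r /bp0 /bm0 /cp /cm // addrC.
Qed.

Lemma mact_Kmat l v x : mact (@Kmat R tau L theta zeta l) v x =
  (if x.1 then Defs.kplus tau theta zeta l else Defs.kminus tau zeta l) * v x.
Proof.
rewrite /mact /Kmat (bigD1 x) //= eqxx big1 ?addr0 // => y yx.
by rewrite eq_sym (negPf yx) mul0r.
Qed.

Local Notation chain := (@chain C).

Fixpoint enc (js : seq 'I_L) (s : W) : chain (map mu js) :=
  match js with
  | [::] => tt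
  | j :: js' => (s j, enc js' s)
  end.

Lemma enc_upd js s j c : j \notin js -> enc js (upd s j c) = enc js s.
Proof.
elim: js => //= i js IH; rewrite inE negb_or => /andP[ij jjs].
by rewrite IH // updE eq_sym (negPf ij).
Qed.

Local Notation hgt := (height gamma theta).

Lemma height_enc js s :
  hgt (enc js s) = theta - gamma * \sum_(i <- js) sgn R (s i).
Proof.
elim: js => [|j js IH] /=; first by rewrite big_nil mulr0 subr0.
by rewrite /Th1 /= IH big_cons /sgn; case: (s j); rewrite /sh; ring.
Qed.

(** The enumeration of sites is increasing, so the entries after j are exactly the sites of larger
    index that shift its parameter. *)
Lemma dynth_enc l1 j js s : enum 'I_L = l1 ++ j :: js ->
  dynth gamma theta j s = hgt (enc js s).
Proof.
move=> eL; rewrite height_enc; congr (_ - _ * _).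
have : pairwise ltn [seq val i | i <- enum 'I_L].
  by rewrite val_enum_ord -sorted_pairwise ?iota_ltn_sorted //; apply:
    ltn_trans.
rewrite eL map_cat pairwise_cat /= => /and3P[h1 _ /andP[h2 _]].
have -> : index_enum 'I_L = enum 'I_L by rewrite [index_enum _]unlock -enumT.
rewrite eL big_cat big_cons /= ltnn.
rewrite big_seq_cond big1 ?add0r; last first.
  move=> i /andP[il1 ji]; move/allrelP: h1.
  move=> /(_ (val i) (val j)); rewrite map_f // inE eqxx => /(_ isT isT) ij.
  by move: (ltn_trans ij ji); rewrite ltnn.
rewrite big_seq_cond [RHS]big_seq_cond; apply: eq_bigl => i.
case: (boolP (i \in js)) => //= ijs.
by have /= -> := allP h2 (val i) (map_f val ijs).
Qed.

(** The double row operator with only the sites [js]; as a suffix of the enumeration these are the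
    sites nearest the wall. *)
Definition site_act l (js : seq 'I_L) (G : St L -> C) : St L -> C :=
  foldr (fun M => mact M)
    (mact (@Kmat R tau L theta zeta l)
      (foldr (fun M => mact M) G
        (rev [seq Rj0 tau gamma (l + mu j) theta j | j <- js])))
    [seq R0j tau gamma (l - mu j) theta j | j <- js].

Local Notation row0 := (double_row0 f gamma theta zeta).

(** Induction on the suffix [js]. Agreement of [G] and [v] is asked only on configurations equal to
    [s] off [js], the only ones these operators can reach. *)
Lemma site_actE l js l1 : f (theta + zeta + l) != 0 -> enum 'I_L = l1 ++ js ->
  forall (G : St L -> C) (v : bool -> chain (map mu js) -> C) (s : W),
  (forall a (s' : W), (forall k, k \notin js -> s' k = s k) ->
    G (a, s') = v a (enc js s')) ->
  forall a, f (theta + zeta + l) * site_act l js G (a, s) = row0 l v a (enc js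
    s).
Proof.
move=> hl; elim: js l1 => [|j js IH] l1 eL G v s hG a.
  rewrite /site_act /= mact_Kmat hG //= /wall_op; case: a; rewrite /=.
    rewrite /Defs.kplus /wall_up mulrA; congr (_ * _).
    by rewrite mulrC divfK.
  by rewrite /Defs.kminus /wall_down mulrA [X in X * _]mulrC.
have uL : uniq (enum 'I_L) := enum_uniq _.
have jjs : j \notin js.
  by move: uL; rewrite eL cat_uniq => /and3P[_ _ /= /andP[]].
have eL' : enum 'I_L = rcons l1 j ++ js by rewrite cat_rcons.
have -> : site_act l (j :: js) G = mact (R0j tau gamma (l - mu j) theta j)
    (site_act l js (mact (Rj0 tau gamma (l + mu j) theta j) G)).
  by rewrite /site_act /= rev_cons foldr_rcons.
rewrite mact_R0j (dynth_enc s eL) /=.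
have ract0Z t l' k x p q : k * face_act0 f gamma l' t x p q =
    face_act0 f gamma l' t (fun p q => k * x p q) p q.
  by case: p; case: q; rewrite /face_act0; ring.
rewrite ract0Z; congr (face_act0 _ _ _ _ _ _ _).
apply/funext => b; apply/funext => c; rewrite -(enc_upd s c jjs).
apply: (IH _ eL') => d s' hs'.
have s'j : s' j = c by rewrite hs' // updE eqxx.
rewrite mact_Rj0 (dynth_enc s' eL) s'j; congr (face_act0 _ _ _ _ _ _ _).
apply/funext => e; apply/funext => b'.
rewrite hG /=; last first.
  move=> k; rewrite inE negb_or => /andP[kj kjs].
  by rewrite updE (negPf kj) hs' // updE (negPf kj).
by rewrite updE eqxx enc_upd.
Qed.

Lemma Tdouble_act l v a s : f (theta + zeta + l) != 0 ->
  f (theta + zeta + l) *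
    mact (Tdouble tau gamma theta zeta mu l) (fun x => v x.1 (enc (enum 'I_L)
      x.2))
      (a, s) = row0 l v a (enc (enum 'I_L) s).
Proof.
move=> hl; rewrite -(@site_actE l _ [::] hl (erefl _)
  (fun x => v x.1 (enc (enum 'I_L) x.2))) //.
rewrite /Tdouble mact_opprod /= /Tmon /Tbar /site_act.
by rewrite !mact_opprod.
Qed.

Local Notation rowL :=
  (@double_row0 C f gamma theta zeta (map mu (enum 'I_L))).

Lemma Bop_act l u w : f (theta + zeta + l) != 0 ->
  f (theta + zeta + l) *
    mact (Bop tau gamma theta zeta mu l) (fun w => u (enc (enum 'I_L) w)) w =
  comp rowL true false l u (enc (enum 'I_L) w).
Proof.
move=> hl; rewrite /comp -Tdouble_act //; congr (_ * _).
rewrite /mact /Bop.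
rewrite (eq_bigr (fun y : St L => (fun b (y : W) =>
    Tdouble tau gamma theta zeta mu l (true, w) (b, y) *
    (if b == false then u (enc (enum 'I_L) y) else 0)) y.1 y.2)); last by case.
rewrite -(pair_bigA _ (fun b (y : W) =>
    Tdouble tau gamma theta zeta mu l (true, w) (b, y) *
    (if b == false then u (enc (enum 'I_L) y) else 0))) /= big_bool /=.
by rewrite [X in _ = X + _]big1 ?add0r // => y _; rewrite mulr0.
Qed.

(** Each B contributes one factor, the one by which [wall_op] exceeds K. *)
Lemma Zpf_partition_fn0 (l : 'I_L -> C) :
  (forall k, f (theta + zeta + l k) != 0) ->
  (\prod_k f (theta + zeta + l k)) * Zpf tau gamma theta zeta mu l =
  partition_fn0 f gamma theta zeta (map mu (enum 'I_L)) (map l (enum 'I_L)).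
Proof.
move=> hl; pose up : W := [ffun=> true].
have upE (js : seq 'I_L) (w : W) : (forall k, k \notin js -> w k = true) ->
    all_up (enc js w) = (w == up)%:R :> C.
  elim: js w => [|j js IH] w hw /=.
    suff -> : w = up by rewrite eqxx.
    by apply/ffunP => k; rewrite ffunE hw.
  case hj : (w j).
    apply: IH => k; case: (eqVneq k j) => [-> //|kj kjs]; apply: hw.
    by rewrite inE negb_or kj.
  case: eqP => // /(congr1 (fun h : W => h j)); rewrite ffunE hj //.
have downE js : enc js [ffun=> false] = all_down (map mu js).
  by elim: js => //= j js ->; rewrite ffunE.
have act (w : W) ks : \prod_(k <- ks) f (theta + zeta + l k) *
    foldr (fun M => mact M) (fun y => (y == up)%:R)
      [seq Bop tau gamma theta zeta mu (l k) | k <- ks] w =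
    bstate rowL (all_up (ms := _)) (map l ks) (enc (enum 'I_L) w).
  elim: ks w => [|k ks IH] w /=.
    by rewrite big_nil mul1r upE // => k; rewrite mem_enum.
  rewrite big_cons -Bop_act // -mulrA -mactZ.
  by congr (_ * mact _ _ _); apply/funext => y; rewrite IH.
rewrite /partition_fn0 -downE -act big_enum /=; congr (_ * _).
rewrite -mact_opprod /mact /Zpf (bigD1 up) //= eqxx mulr1 big1 ?addr0 // => y
  yu.
by rewrite (negPf yu) mulr0.
Qed.

End Transfer.

(** * Proof of the functional equation *)

Section Assembly.
Local Open Scope complex_scope.
Local Opaque ef.
Variables (R : realType) (tau : R[i]).
Local Notation C := (R[i]).
Local Notation f := (ef tau).

Hypothesis fN : forall x, f (- x) = - f x.
Hypothesis fay : forall e p q r,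
  f e * f p * f (e + p - q - r) * f (r - q)
  - f (e + p - q) * f q * f (e - r) * f (r - p)
  + f (e + p - r) * f r * f (e - q) * f (q - p) = 0.

Variables (gamma theta zeta : C) (L : nat) (mu : 'I_L -> C) (lam : 'I_L.+1 ->
  C).
Local Notation g := gamma.
Local Notation ms := [seq mu j | j <- enum 'I_L].
Local Notation H l := (f (theta + zeta + l)).
Local Notation Z l := (Zpf tau gamma theta zeta mu l).
Local Notation M := (Mcoef tau gamma theta zeta mu lam).
Let lams (k : 'I_L) := lam (lift ord0 k).
Let ls := [seq lams k | k <- enum 'I_L].
Local Notation Z0 := (partition_fn0 f gamma theta zeta ms).

Hypothesis L0 : (0 < L)%N.
Hypothesis hn : forall k : int, (`|k| <= L%:Z)%R -> f (theta + k%:~R * g) != 0.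
Hypothesis hH : forall i, H (lam i) != 0.
Hypothesis h2 : forall i, f (2 * lam i + g) != 0.
Hypothesis hs : forall i j, i != j ->
  f (lam i - lam j) != 0 /\ f (lam i + lam j + g) != 0.

Let h2' i : f (lam i + lam i + g) != 0.
Proof. by rewrite -mulr2n -mulr_natl. Qed.

Let hL : f (theta + (L%:R - 1) * g) != 0.
Proof.
have := hn (k := L%:Z - 1); rewrite intrD mulrNz pmulrn; apply.
by rewrite ler_norml; lia.
Qed.
Let hL' : f (theta - (L%:R - 1) * g) != 0.
Proof.
rewrite -mulNr opprB (_ : 1 - L%:R = (1 - L%:Z)%:~R); last by rewrite intrD
  mulrNz pmulrn.
by apply: hn; rewrite ler_norml; lia.
Qed.
Let hL'' : f (theta - L%:R * g) != 0.
Proof.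
rewrite -mulNr [L%:R]pmulrn -mulrNz; apply: hn.
by rewrite ler_norml; lia.
Qed.

Lemma M_ord0 : H (lam ord0) * M ord0 = eigAbar f g theta zeta ms (lam ord0)
  - eigA f g theta zeta ms (lam ord0) * \prod_(l <- ls) pfac f g l (lam ord0).
Proof.
rewrite /Mcoef unlift_none /M0 mulrBr mulrA; congr (_ - _ * _).
- exact: eigAbar_formula.
- exact: eigA_formula.
- by rewrite prod_enum.
Qed.

Lemma M_lift i : H (lams i) * M (lift ord0 i) =
  - mcoef f g (eigA f g theta zeta ms) (lam ord0) (lams i) (skip i ls)
      (theta + g *+ L.-1).
Proof.
have [hi1 hi2] : _ := hs (i := lift ord0 i) (j := ord0) isT.
have h2i := h2' (lift ord0 i); have hHi := hH (lift ord0 i).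
by rewrite /Mcoef liftK; apply: mcoef_formula.
Qed.

Lemma sep_lam i j : i != j -> separated f g (lam j) (lam i).
Proof. by move=> ij; apply/andP; apply: hs. Qed.

Lemma functional_equation :
  \sum_(nu < L.+1) M nu * Z (fun k => lam (lift nu k)) = 0.
Proof.
have P0 : \prod_k H (lam k) != 0 by apply/prodf_neq0 => k _.
apply: (mulfI P0); rewrite mulr0 mulr_sumr.
(* The partition function of index nu omits lam nu, so the full product leaves exactly one factor
   over, which multiplies M_nu. *)
have term nu : \prod_k H (lam k) * (M nu * Z (fun k => lam (lift nu k))) =
    H (lam nu) * M nu * Z0 [seq lam (lift nu k) | k <- enum 'I_L].
  rewrite -(@Zpf_partition_fn0 R tau gamma theta zeta L mu (fun k => lam (lift
    nu k))) //.
  by rewrite (bigD1_ord nu) //=; ring.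
rewrite (eq_bigr _ (fun nu _ => term nu)) big_ord_recl M_ord0.
have szm : size ms = L by rewrite size_map size_enum_ord.
have szl : size ls = L by rewrite (size_map lams) size_enum_ord.
have adm : admissible f g ls.
  apply: admissible_map (enum_uniq _) _ _ => [i|i j ij]; first exact: h2'.
  by apply: sep_lam; rewrite (inj_eq lift_inj) eq_sym.
have sep : all (separated f g (lam ord0)) ls.
  by apply/allP => _ /mapP[k _ ->]; apply: sep_lam.
have ns : nonsingular f g theta (size ms).
  by move=> k; rewrite szm => /hn; rewrite mulrzl.
have := @partition_fn0_eq _ _ fN fay g theta zeta ms (lam ord0) ls.
rewrite szl szm => /(_ L0 erefl) E.
have {}E := E _ _ adm sep.
(* By [E] the term of index 0 equals the sum of the [mcoef] terms, which the remaining indices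
   contribute with the opposite sign. *)
rewrite mulrBl -[X in X - _]/(_ * Z0 ls) E //; last by rewrite -szm.
rewrite [X in X - _]addrC addrK -big_split /= big1 // => i _.
rewrite M_lift enum_lift_cons (nth_map i) ?size_enum_ord // nth_ord_enum.
by rewrite mulNr subrr.
Qed.

End Assembly.

Theorem theorem3p1 (R : realType) (tau gamma theta zeta : R[i]) (L : nat)
    (mu : 'I_L -> R[i]) (lam : 'I_L.+1 -> R[i]) :
  (0 < complex.Im tau)%R ->
  (1 <= L)%N ->
  (* genericity: all denominators occurring in the model and in the M_nu
     are nonzero *)
  (forall k : int, (`|k| <= L%:Z)%R ->
     ef tau (theta + k%:~R * gamma) != 0) ->
  (forall i : 'I_L.+1, ef tau (theta + zeta + lam i) != 0) ->
  (forall i : 'I_L.+1, ef tau (2 * lam i + gamma) != 0) ->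
  (forall i j : 'I_L.+1, i != j ->
     ef tau (lam i - lam j) != 0 /\ ef tau (lam i + lam j + gamma) != 0) ->
  \sum_(nu < L.+1)
     Mcoef tau gamma theta zeta mu lam nu
     * Zpf tau gamma theta zeta mu (fun k : 'I_L => lam (lift nu k)) = 0.
Proof.
move=> tau0 L0 hk hH h2 hs.
exact: (functional_equation (efN tau0) (ef_fay tau0) mu L0 hk hH h2 hs).
Qed.
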